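(* Let $V$ be the defining representation of $\mathfrak{so}(\infty;\mathbb C)$, and let $\mathfrak p$ be a parabolic subalgebra given by infinite trace conditions on the $\mathfrak{so}(\infty;\mathbb C)$-stabilizer of a self-taut generalized flag $\mathcal F$ in $V$. Then there are two possibilities: 1. $\mathcal F$ is uniquely determined by $\mathfrak p$; 2. there are exactly three self-taut generalized flags with the same stabilizer as $\mathcal F$. The latter case occurs precisely when there exists an isotropic subspace $L\in\mathcal F$ with $\dim_{\mathbb C}L^\perp/L=2$. The three flags with the same stabilizer are then - $\{F\in\mathcal F\mid F\subset L\text{ or }L^\perp\subset F\}$, - $\{F\in\mathcal F\mid F\subset L\text{ or }L^\perp\subset F\}\cup\{M_1\}$, - $\{F\in\mathcal F\mid F\subset L\text{ or }L^\perp\subset F\}\cup\{M_2\}$, where $M_1$ and $M_2$ are the two maximal isotropic subspaces containing $L$.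
   Context: $V$ is a countable-dimensional complex vector space with a nondegenerate symmetric bilinear form $\langle\cdot,\cdot\rangle$. $\mathfrak{gl}(\infty;\mathbb C)$ is identified with the Lie algebra of finite-rank operators on $V$ spanned by $x\mapsto\langle x,v\rangle u$ ($u,v\in V$), and $\mathfrak{so}(\infty;\mathbb C)$ with the subalgebra spanned by $x\mapsto\langle x,v\rangle u-\langle x,u\rangle v$. For a subspace $F\subset V$, $F^\perp$ is its orthogonal complement with respect to the form; the closure of $F$ is $F^{\perp\perp}$; $F$ is isotropic if $F\subset F^\perp$. A generalized flag in $V$ is a set of subspaces, totally ordered by inclusion, such that each member has an immediate predecessor or an immediate successor in the set, and every nonzero vector of $V$ lies in $F''\setminus F'$ for some immediate predecessor–successor pair $F'\subset F''$. It is semiclosed if for each such pair the closure of $F'$ is either $F'$ or $F''$. The stabilizer of a generalized flag consists of the elements mapping each of its members into itself. A semiclosed generalized flag $\mathcal F$ is self-taut if for every $F\in\mathcal F$, $F^\perp$ is stable under the $\mathfrak{gl}(\infty;\mathbb C)$-stabilizer of $\mathcal F$. A Lie algebra is locally solvable if every finite subset lies in a solvable subalgebra. A parabolic subalgebra is a subalgebra containing a Borel (i.e. maximal locally solvable) subalgebra. Let $\mathfrak s$ be a subalgebra of $\mathfrak{gl}(\infty;\mathbb C)$ containing the Jordan components of its elements. Its locally solvable radical is the sum of its locally solvable ideals, and its linear nilradical $\mathfrak m$ is the set of all nilpotent elements of that radical. A subalgebra $\mathfrak q\subset\mathfrak s$ is defined by trace conditions on $\mathfrak s$ if $\mathfrak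 m\subset\mathfrak q$ and $[\mathfrak s,\mathfrak s]/\mathfrak m\subset\mathfrak q/\mathfrak m\subset\mathfrak s/\mathfrak m$, in other words if there is a family $\mathrm{Tr}$ of Lie algebra homomorphisms $f:\mathfrak s\to\mathbb C$ with joint kernel equal to $\mathfrak q$. It is defined (given) by infinite trace conditions if, further, every $f\in\mathrm{Tr}$ annihilates every finite-dimensional simple ideal in $[\mathfrak s,\mathfrak s]/\mathfrak m$.
   Formalization: The isotropic subspace L with dim L^⊥/L = 2 is additionally required to be closed (L^⊥⊥ = L); for non-closed L only one maximal isotropic subspace contains L, and the printed criterion fails. *)

(* Defs.v *)
From mathcomp Require Import all_boot all_order all_algebra.
From mathcomp Require Import complex sesquilinear.
From mathcomp Require Import all_classical reals.

Set Implicit Arguments.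
Unset Strict Implicit.
Unset Printing Implicit Defensive.

Import Order.TTheory GRing.Theory Num.Theory.
Local Open Scope classical_set_scope.
Local Open Scope ring_scope.
Local Open Scope complex_scope.

Section Subspaces.
Variables (R : realType) (W : lmodType R[i]).
Implicit Types (S U Q : set W).

Definition subspace U : Prop :=
  U 0 /\ forall (a : R[i]) (x y : W), U x -> U y -> U (a *: x + y).

Definition lspan S : set W := smallest subspace S.

(* dim (Q / U) = n: the classes of b_0, ..., b_(n-1) are a basis of Q / U. *)
Definition quot_dim Q U (n : nat) : Prop :=
  U `<=` Q /\
  exists b : 'I_n -> W,
    [/\ forall i, Q (b i),
        forall c : 'I_n -> R[i], U (\sum_i c i *: b i) -> forall i, c i = 0 &
        forall x, Q x -> exists c : 'I_n -> R[i], U (x - \sum_i c i *: b i)].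

(* Infinite countable dimension: there is a basis indexed by nat. *)
Definition countable_dimensional : Prop :=
  exists e : nat -> W,
    (forall n (c : 'I_n -> R[i]), \sum_(i < n) c i *: e i = 0 ->
       forall i, c i = 0) /\
    (forall x : W, exists n (c : 'I_n -> R[i]), x = \sum_(i < n) c i *: e i).

End Subspaces.

(* Lie algebras of operators: a Lie algebra is a set of functions V -> V that
   is a subspace for the pointwise operations and is closed under lie; all of
   them below lie in gl_infty, hence consist of linear maps. *)
Section LieAlgebras.
Variables (R : realType) (V : lmodType R[i]).
Implicit Types (X Y : V -> V) (g h i m q s : set (V -> V)).

Definition lie X Y : V -> V := fun x => X (Y x) - Y (X x).

Definition lie_subalgebra g h : Prop :=
  [/\ subspace h, h `<=` g & forall X Y, h X -> h Y -> h (lie X Y)].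

Definition lie_ideal g i : Prop :=
  [/\ subspace i, i `<=` g & forall X Y, g X -> i Y -> i (lie X Y)].

Definition derived g : set (V -> V) :=
  lspan [set Z | exists X Y, [/\ g X, g Y & Z = lie X Y]].

Definition lie_solvable g : Prop := exists n, iter n derived g = [set 0].

Definition locally_solvable g : Prop :=
  forall A : set (V -> V), finite_set A -> A `<=` g ->
    exists h, [/\ lie_subalgebra g h, lie_solvable h & A `<=` h].

Definition borel_subalgebra g b : Prop :=
  [/\ lie_subalgebra g b, locally_solvable b &
      forall b', lie_subalgebra g b' -> locally_solvable b' ->
        b `<=` b' -> b' = b].

Definition parabolic_subalgebra g q : Prop :=
  lie_subalgebra g q /\ exists b, borel_subalgebra g b /\ b `<=` q.

Definition locally_solvable_radical s : set (V -> V) :=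
  lspan [set X | exists i, [/\ lie_ideal s i, locally_solvable i & i X]].

Definition nilpotent_op X : Prop := exists n, forall v, iter n X v = 0.

Definition linear_nilradical s : set (V -> V) :=
  [set X | locally_solvable_radical s X /\ nilpotent_op X].

(* i / m is a finite-dimensional simple ideal of g / m. Subalgebras and ideals
   of g / m are represented by their preimages, which contain m. *)
Definition fd_simple_ideal_mod m g i : Prop :=
  [/\ lie_ideal g i,
      m `<=` i,
      exists n, quot_dim i m n,
      ~ derived i `<=` m &
      forall j, lie_ideal i j -> m `<=` j -> j = m \/ j = i].

(* Lie algebra homomorphisms s -> C; the bracket of C is zero. Only the values
   on s matter: f may be arbitrary outside s. *)
Definition lie_character s (f : (V -> V) -> R[i]) : Prop :=
  (forall (a : R[i]) X Y, s X -> s Y -> f (a *: X + Y) = a * f X + f Y) /\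
  (forall X Y, s X -> s Y -> f (lie X Y) = 0).

Definition defined_by_traces s (Tr : set ((V -> V) -> R[i])) q : Prop :=
  [/\ lie_subalgebra s q,
      linear_nilradical s `<=` q,
      derived s `<=` q,
      forall f, Tr f -> lie_character s f &
      q = [set X | s X /\ forall f, Tr f -> f X = 0]].

(* [s, s] / m is represented by its preimage [s, s] + m in s. *)
Definition infinite_trace_conditions s q : Prop :=
  exists Tr : set ((V -> V) -> R[i]),
    defined_by_traces s Tr q /\
    forall f, Tr f -> forall i,
      fd_simple_ideal_mod (linear_nilradical s)
        (lspan (derived s `|` linear_nilradical s)) i ->
      forall X, i X -> f X = 0.

End LieAlgebras.

Section Flags.
Variables (R : realType) (V : lmodType R[i]) (B : {symmetric V}).
Implicit Types (E F L M : set V) (FF : set (set V)) (g : set (V -> V)).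

Definition nondegenerate_form : Prop :=
  forall x : V, (forall y, B x y = 0) -> x = 0.

Definition gl_infty : set (V -> V) :=
  lspan [set X | exists u v : V, X = (fun x => B x v *: u)].

Definition so_infty : set (V -> V) :=
  lspan [set X | exists u v : V, X = (fun x => B x v *: u - B x u *: v)].

Definition orth F : set V := [set x | forall y, F y -> B x y = 0].

Definition orth_closure F : set V := orth (orth F).

Definition isotropic F : Prop := subspace F /\ F `<=` orth F.

Definition maximal_isotropic M : Prop :=
  isotropic M /\ forall M', isotropic M' -> M `<=` M' -> M' = M.

Definition immediate_pair FF E F : Prop :=
  [/\ FF E, FF F, E `<` F &
      forall G, FF G -> E `<=` G -> G `<=` F -> G = E \/ G = F].

Definition generalized_flag FF : Prop :=
  [/\ forall F, FF F -> subspace F,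
      forall E F, FF E -> FF F -> E `<=` F \/ F `<=` E,
      forall F, FF F ->
        exists G, immediate_pair FF G F \/ immediate_pair FF F G &
      forall x : V, x <> 0 ->
        exists E F, [/\ immediate_pair FF E F, F x & ~ E x]].

Definition semiclosed FF : Prop :=
  forall E F, immediate_pair FF E F -> orth_closure E = E \/ orth_closure E = F.

Definition stable (X : V -> V) F : Prop := forall x, F x -> F (X x).

Definition stabilizer g FF : set (V -> V) :=
  [set X | g X /\ forall F, FF F -> stable X F].

Definition self_taut FF : Prop :=
  [/\ generalized_flag FF, semiclosed FF &
      forall F, FF F -> forall X, stabilizer gl_infty FF X -> stable X (orth F)].

(* The self-taut generalized flags with the same so_infty-stabilizer as FF. *)
Definition same_stabilizer_flags FF : set (set (set V)) :=
  [set GG | self_taut GG /\ stabilizer so_infty GG = stabilizer so_infty FF].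

(* FF is recovered from q among all the self-taut generalized flags on whose
   stabilizer q is given by infinite trace conditions. *)
Definition uniquely_determined FF (q : set (V -> V)) : Prop :=
  forall GG, self_taut GG ->
    infinite_trace_conditions (stabilizer so_infty GG) q -> GG = FF.

(* L is a member of FF, isotropic, with dim (L^perp / L) = 2. The condition
   that L be its own closure is what makes the form of L^perp / L
   nondegenerate, so that there are two maximal isotropic subspaces containing
   L. It cannot be dropped: if L is dense of codimension 2 in some
   M = M^perp, then L^perp = M, so L is isotropic with dim (L^perp / L) = 2,
   and {0, L, M, V} is a self-taut generalized flag, but M is the only maximal
   isotropic subspace containing L and no other self-taut generalized flag has
   the same stabilizer. *)
Definition hyperbolic_plane_member FF L : Prop :=
  [/\ FF L, isotropic L, orth_closure L = L & quot_dim (orth L) L 2].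

Definition two_maximal_isotropics L M1 M2 : Prop :=
  M1 <> M2 /\
  forall M, (maximal_isotropic M /\ L `<=` M) <-> (M = M1 \/ M = M2).

Definition truncated_flag FF L : set (set V) :=
  [set F | FF F /\ (F `<=` L \/ orth L `<=` F)].

End Flags.

(* Main.v *)
(* Write s for the so-stabilizer of a self-taut flag and m for its linear
   nilradical, so that [s, s] + m <= p <= s. For each nonzero x in V let (E,
   F) be the immediate pair of the flag with x in F \ E; the flag is
   determined by the spaces F. A p-stable subspace containing x contains E,
   and also F when E is closed: the elements of p that show this are of the
   form u /\ v, found in nilpotent ideals attached to isotropic members, or
   as commutators acting through sl or so on F / E. When E is not closed, E
   + C x is p-stable and F is the closure of E. Hence p determines F, except
   when the action of p on F / E is too small, and this happens only for x
   in L^perp \ L with L a member of the flag and L^perp / L a hyperbolic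
   plane, whose two isotropic lines are stable under so(2). *)

Require Import Defs.
From mathcomp Require Import all_boot all_order all_algebra.
From mathcomp Require Import complex sesquilinear ring.
From mathcomp Require Import all_classical reals.
Local Open Scope classical_set_scope.
Local Open Scope ring_scope.
Local Open Scope complex_scope.

Set Implicit Arguments.
Unset Strict Implicit.
Unset Printing Implicit Defensive.
Import GRing.Theory Num.Theory.

(** * Subspaces *)

Section Subspace.
Variables (R : realType) (W : lmodType R[i]).
Implicit Types (U S : set W) (x y z : W) (a : R[i]).

(** Members of either flag are stable under [p], so what one flag forces on a [p]-stable subspace
    applies to members of the other; two flags are compared in this way. Three obstacles shape the
    work. The orthogonal complement of a member need not be a member; self-tautness only makes it
    compatible with the flag: for an immediate pair (E, F) and a member G, G^perp contains F or lies
    in E. Next, E may be dense in F. The operators have finite rank, so one that preserves E carries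
    cl E into E, and [p] never leads from E + C x to the rest of F; that two flags cannot have a
    closed E and a nonclosed E' at the same nonexceptional vector needs its own argument. Finally,
    commutators must act richly on F / E. Writing z /\ v as a commutator in so(n) takes a third
    direction, missing for n = 2; and if E = E^perp has codimension one in F, sl(F / E) vanishes and
    the nilpotent elements miss a direction of E. Both situations yield a hyperbolic plane, whose
    member L is recovered from [p] because the incomparable L + C e and L + C f cannot lie in one
    flag. *)

Lemma subspace0 U : subspace U -> U 0.
Proof. by case. Qed.

Lemma subspaceD U x y : subspace U -> U x -> U y -> U (x + y).
Proof. by move=> [_ h] Ux Uy; rewrite -[x]scale1r; exact: h. Qed.

Lemma subspaceZ U a x : subspace U -> U x -> U (a *: x).
Proof. by move=> [U0 h] Ux; rewrite -[_ *: _]addr0; exact: h. Qed.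

Lemma subspaceN U x : subspace U -> U x -> U (- x).
Proof. by move=> hU Ux; rewrite -scaleN1r; exact: subspaceZ. Qed.

Lemma subspaceB U x y : subspace U -> U x -> U y -> U (x - y).
Proof. by move=> hU Ux Uy; apply: subspaceD => //; exact: subspaceN. Qed.

Lemma subspaceZK U a x : subspace U -> a != 0 -> U (a *: x) -> U x.
Proof.
by move=> hU a0 /(subspaceZ a^-1 hU); rewrite scalerA mulVf // scale1r.
Qed.

Lemma subspaceBK U x y : subspace U -> U (x - y) -> U y -> U x.
Proof. by move=> hU Uxy Uy; rewrite -[x](subrK y); exact: subspaceD. Qed.

Lemma lspan_subspace S : subspace (lspan S).
Proof.
split=> [U [[U0 _] _] //|a x y Sx Sy U SU].
by case: (SU) => -[_ h] _; apply: h; [exact: Sx | exact: Sy].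
Qed.

Lemma lspan_sub S U : subspace U -> S `<=` U -> lspan S `<=` U.
Proof. by move=> hU SU x; apply. Qed.

Lemma sub_lspan S : S `<=` lspan S.
Proof. by move=> x Sx U [_]; apply. Qed.

Definition add_line U z : set W := [set x | exists c, U (x - c *: z)].

Lemma add_line_subspace U z : subspace U -> subspace (add_line U z).
Proof.
move=> hU; split=> [|a x y [c Uc] [d Ud]].
  by exists 0; rewrite scale0r subr0; exact: subspace0.
exists (a * c + d).
have -> : a *: x + y - (a * c + d) *: z = a *: (x - c *: z) + (y - d *: z).
  by rewrite scalerBr scalerDl -scalerA opprD addrACA.
by apply: subspaceD => //; exact: subspaceZ.
Qed.

Lemma sub_add_line U z : U `<=` add_line U z.
Proof. by move=> x Ux; exists 0; rewrite scale0r subr0. Qed.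

Lemma add_line_self U z : subspace U -> add_line U z z.
Proof. by move=> hU; exists 1; rewrite scale1r subrr; exact: subspace0. Qed.

Lemma add_line_min U z N : subspace N -> U `<=` N -> N z -> add_line U z `<=` N.
Proof.
move=> hN UN Nz x [c /UN h].
by apply: (subspaceBK hN h); exact: subspaceZ.
Qed.

Lemma add_line_exchange U x z : subspace U ->
  add_line U z x -> ~ U x -> add_line U x z.
Proof.
move=> hU [c Uc] nUx.
have c0 : c != 0.
  by apply/eqP => c0; apply: nUx; move: Uc; rewrite c0 scale0r subr0.
exists c^-1; apply: (subspaceZK (a := - c) hU); first by rewrite oppr_eq0.
have -> // : - c *: (z - c^-1 *: x) = x - c *: z.
by rewrite scalerBr scalerA mulNr mulfV // scaleN1r opprK scaleNr addrC.
Qed.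

Lemma add_lineS U U' z : U `<=` U' -> add_line U z `<=` add_line U' z.
Proof. by move=> UU x [c /UU h]; exists c. Qed.

(** Steinitz exchange modulo U: the bound dim Q / U <= 2 does not depend on the spanning pair, so
    its failure for one independent pair x, y excludes every other pair. *)
Lemma add_line2_exchange U Q x y z t : subspace U -> ~ U x -> ~ add_line U x y ->
    Q x -> Q y -> Q `<=` add_line (add_line U z) t ->
  Q `<=` add_line (add_line U x) y.
Proof.
move=> hU nx ny Qx Qy hQ.
have [hx hz] := (add_line_subspace x hU, add_line_subspace z hU).
have [hxy hzt] := (add_line_subspace y hx, add_line_subspace t hz).
suff [q hq] : exists q, Q `<=` add_line (add_line U x) q.
  have hyq := add_line_exchange hx (hq _ Qy) ny.
  apply: (subset_trans hq); apply: (add_line_min hxy) => //; exact: sub_add_line.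
have [Uzx|nUzx] := pselect (add_line U z x).
  exists t; apply: (subset_trans hQ); apply: add_lineS.
  apply: (add_line_min hx); first exact: sub_add_line.
  exact: add_line_exchange.
have hxz := add_line_subspace z hx; have hzx := add_line_subspace x hz.
exists z; apply: (subset_trans hQ); apply: (@subset_trans _ (add_line (add_line U z) x)).
  apply: (add_line_min hzx); first exact: sub_add_line.
  exact: (add_line_exchange hz (hQ _ Qx)).
apply: (add_line_min hxz); first by apply: add_lineS; exact: sub_add_line.
by apply: sub_add_line; exact: add_line_self.
Qed.

Lemma quot_dim2P Q U : quot_dim Q U 2 <-> U `<=` Q /\ exists x y,
  [/\ Q x, Q y, forall c d, U (c *: x + d *: y) -> c = 0 /\ d = 0 &
      forall z, Q z -> exists c d, U (z - (c *: x + d *: y))].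
Proof.
have sumE (b : 'I_2 -> W) (c : 'I_2 -> R[i]) :
    \sum_i c i *: b i = c 0 *: b 0 + c 1 *: b 1.
  by rewrite big_ord_recl big_ord1; congr (_ + c _ *: b _); exact: val_inj.
split=> -[UQ].
  move=> [b [Qb free span]]; split=> //; exists (b 0), (b 1); split=> //.
    move=> c d h; have := free (fun i => if i == 0 then c else d).
    by rewrite sumE => /(_ h) h'; split; [exact: (h' 0) | exact: (h' 1)].
  by move=> z /span[c]; rewrite sumE; exists (c 0), (c 1).
move=> [x [y [Qx Qy free span]]]; split=> //.
exists (fun i => if i == 0 then x else y); split.
- by move=> i; case: ifP.
- move=> c; rewrite sumE => /free[c0 c1] i.
  by case: i => -[|[|//]] h; [rewrite -c0|rewrite -c1]; congr (c _); exact: val_inj.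
- move=> z /span[c [d h]].
  by exists (fun i => if i == 0 then c else d); rewrite sumE.
Qed.

Lemma quot_dim2_lines Q U x y : subspace U -> U `<=` Q -> Q x -> Q y ->
    ~ U x -> ~ add_line U x y -> Q `<=` add_line (add_line U x) y ->
  quot_dim Q U 2.
Proof.
move=> hU UQ Qx Qy nx ny span; apply/quot_dim2P; split=> //; exists x, y; split=> //.
  move=> c d h.
  have d0 : d = 0.
    apply: contrapT => /eqP d0; apply: ny; exists (- d^-1 * c).
    apply: (subspaceZK hU d0).
    by rewrite scalerBr scalerA mulNr mulrN mulrA mulfV // mul1r scaleNr opprK addrC.
  split=> //; move: h; rewrite d0 scale0r addr0 => h.
  by apply: contrapT => /eqP c0; apply: nx; exact: (subspaceZK hU c0).
by move=> z /span[d [c h]]; exists c, d; rewrite opprD addrA addrAC.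
Qed.

End Subspace.

(** * Orthogonal complements, closures and separation by the form *)

Section Form.
Variables (R : realType) (V : lmodType R[i]) (B : {symmetric V}).
Hypothesis hB : nondegenerate_form B.
Implicit Types (x y z u v w : V) (D E F G H K L M N : set V) (a c : R[i]).

Lemma formC x y : B x y = B y x.
Proof. by rewrite (hermC B) /= expr0 mul1r. Qed.

Lemma formDl x y z : B (x + y) z = B x z + B y z.
Proof. exact: linearDl. Qed.

Lemma formZl a x z : B (a *: x) z = a * B x z.
Proof. exact: linearZl_LR. Qed.

Lemma formNl x z : B (- x) z = - B x z.
Proof. exact: linearNl. Qed.

Lemma form0l z : B 0 z = 0.
Proof. exact: linear0l. Qed.

Lemma formDr x y z : B z (x + y) = B z x + B z y.
Proof. by rewrite formC formDl !(formC z). Qed.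

Lemma formZr a x z : B z (a *: x) = a * B z x.
Proof. by rewrite formC formZl (formC z). Qed.

Lemma formNr x z : B z (- x) = - B z x.
Proof. by rewrite formC formNl (formC z). Qed.

Lemma form0r z : B z 0 = 0.
Proof. by rewrite formC form0l. Qed.

Definition formE := (formDl, formDr, formNl, formNr, formZl, formZr, form0l, form0r).

(* Nondegeneracy turns identities between vectors into ring identities. *)
Lemma form_ext x y : (forall w, B x w = B y w) -> x = y.
Proof.
move=> h; apply/eqP; rewrite -subr_eq0; apply/eqP; apply: hB => w.
by rewrite !formE h subrr.
Qed.

Lemma orth_subspace F : subspace (orth B F).
Proof.
split=> [y _|a x y hx hy z Fz]; first by rewrite form0l.
by rewrite !formE hx // hy // mulr0 addr0.
Qed.

Lemma orthS E F : E `<=` F -> orth B F `<=` orth B E.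
Proof. by move=> EF x hx y /EF; exact: hx. Qed.

Lemma sub_closure F : F `<=` orth_closure B F.
Proof. by move=> x Fx y hy; rewrite formC; exact: hy. Qed.

Lemma orth_closed F : orth_closure B (orth B F) = orth B F.
Proof. by apply/seteqP; split; [apply: orthS|]; exact: sub_closure. Qed.

Lemma closureS E F : E `<=` F -> orth_closure B E `<=` orth_closure B F.
Proof. by move=> /orthS/orthS. Qed.

Lemma closure_subspace F : subspace (orth_closure B F).
Proof. exact: orth_subspace. Qed.

Lemma not_orth F x : subspace F -> ~ orth B F x -> exists2 y, F y & B x y = 1.
Proof.
move=> hF /existsNP[y /not_implyP[Fy /eqP n0]].
by exists ((B x y)^-1 *: y); rewrite ?formE ?mulVf//; exact: subspaceZ.
Qed.

Lemma separate_closed D x : orth_closure B D = D -> ~ D x ->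
  exists2 v, orth B D v & B x v = 1.
Proof. by move=> {1}<- /not_orth; apply; exact: orth_subspace. Qed.

Lemma separate_line F x z : subspace F -> ~ add_line (orth B F) z x ->
  exists v, [/\ F v, B z v = 0 & B x v = 1].
Proof.
move=> hF nx.
have [Fz|/(not_orth hF)[w Fw zw]] := pselect (orth B F z).
  have [|v Fv xv] := not_orth (x := x) hF.
    by move=> Fx; apply: nx; exact: sub_add_line.
  by exists v; split=> //; exact: Fz.
(* As B z w = 1, subtracting B z v w from v clears the pairing with z and turns the pairing with x
   into that of x - B x w z with v. *)
have [|v Fv xv] := not_orth (x := x - B x w *: z) hF.
  by move=> h; apply: nx; exists (B x w).
exists (v - B z v *: w); split.
- by apply: (subspaceB hF) => //; exact: (subspaceZ _ hF).
- by rewrite !formE zw; ring.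
- by rewrite -xv !formE; ring.
Qed.

(** Read backwards, a nonclosed subspace has infinite codimension over any closed one inside it;
    this provides the room for commutators in dense pairs. *)
Lemma add_line_closed D z : subspace D -> orth_closure B D = D ->
  orth_closure B (add_line D z) = add_line D z.
Proof.
move=> hD cD; apply/seteqP; split; last exact: sub_closure.
move=> x hx; apply: contrapT => nx.
rewrite -cD in nx; have [v [Dv zv xv]] := separate_line (orth_subspace D) nx.
have := hx v; rewrite xv => h; have /eqP := oner_neq0 R[i]; apply; apply: h.
move=> y [c /Dv]; rewrite !formE [B v z]formC zv mulr0 oppr0 addr0; exact.
Qed.

(** A vector orthogonal to the kernel of v on E becomes orthogonal to E after subtracting a multiple
    of v, and x does not see that multiple. *)
Lemma closure_kernel E v x : subspace E -> orth_closure B E x -> B x v = 0 ->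
  orth_closure B [set y | E y /\ B y v = 0] x.
Proof.
move=> hE cx xv w hw.
have [Ev|/(not_orth hE)[e Ee ve]] := pselect (orth B E v).
  by apply: cx => y Ey; apply: hw; split=> //; rewrite formC; exact: Ev.
have -> : B x w = B x (w - B w e *: v) by rewrite !formE xv; ring.
apply: cx => f Ef.
have <- : B w (f - B f v *: e) = B (w - B w e *: v) f.
  by rewrite !formE (formC f v); ring.
apply: hw; split; first by apply: subspaceB => //; exact: subspaceZ.
by rewrite !formE (formC e) ve; ring.
Qed.

Lemma kernel_subspace E v : subspace E -> subspace [set y | E y /\ B y v = 0].
Proof.
move=> hE; split=> [|a y z [Ey yv] [Ez zv]].
  by split; [exact: subspace0 | exact: form0l].
split; first by apply: subspaceD => //; exact: subspaceZ.
by rewrite !formE yv zv mulr0 addr0.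
Qed.

(** [orth_closure] is the closure for the weak topology of the functionals B _ v. The values are
    matched one at a time, the error staying in the closure of the kernel. *)
Lemma closure_approx (s : seq V) E x : subspace E -> orth_closure B E x ->
  exists2 y, E y & forall v, v \in s -> B x v = B y v.
Proof.
elim: s E x => [|v s IH] E x hE cx; first by exists 0; [exact: subspace0|].
have [e Ee xev] : exists2 e, E e & B (x - e) v = 0.
  have [Ev|/(not_orth hE)[e Ee ve]] := pselect (orth B E v).
    by exists 0; [exact: subspace0 | rewrite subr0; exact: cx].
  exists (B x v *: e); first exact: subspaceZ.
  by rewrite !formE (formC e) ve mulr1 subrr.
have cxe : orth_closure B E (x - e).
  by apply: (subspaceB (closure_subspace E)) => //; exact: sub_closure.
have [y [Ey yv] ys] := IH _ _ (kernel_subspace v hE) (closure_kernel hE cxe xev).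
exists (y + e); first exact: subspaceD.
move=> w; rewrite inE => /predU1P[->|/ys h].
  by move: xev; rewrite !formE yv add0r => /eqP; rewrite subr_eq0 => /eqP.
by rewrite formDl -h -formDl subrK.
Qed.


(** * Generalized flags *)

Definition straddles (FF : set (set V)) x E F :=
  [/\ immediate_pair FF E F, F x & ~ E x].

Section GeneralizedFlag.
Variable FF : set (set V).
Hypothesis gFF : generalized_flag FF.

Lemma member_subspace F : FF F -> subspace F.
Proof. by case: gFF => h _ _ _; exact: h. Qed.

Lemma member_total E F : FF E -> FF F -> E `<=` F \/ F `<=` E.
Proof. by case: gFF => _ h _ _; exact: h. Qed.

Lemma straddles_ex x : x <> 0 -> exists E F, straddles FF x E F.
Proof. by case: gFF => _ _ _ h; exact: h. Qed.

Lemma straddles_nz x E F : straddles FF x E F -> x <> 0.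
Proof. by case=> -[/member_subspace[E0 _] _ _ _] _ nEx x0; rewrite x0 in nEx. Qed.

Lemma straddles_sub x E F : straddles FF x E F -> E `<=` F.
Proof. by case=> -[_ _ [+ _] _]. Qed.

Lemma straddles_memE x E F : straddles FF x E F -> FF E.
Proof. by case=> -[]. Qed.

Lemma straddles_memF x E F : straddles FF x E F -> FF F.
Proof. by case=> -[]. Qed.

Lemma straddles_in x E F y : straddles FF x E F -> F y -> ~ E y ->
  straddles FF y E F.
Proof. by case. Qed.

Lemma pair_straddles E F : immediate_pair FF E F -> exists x, straddles FF x E F.
Proof.
move=> h; case: (h) => _ _ [_ /existsNP[x /not_implyP[Fx nEx]]] _.
by exists x.
Qed.

Lemma straddles_mem x E F G : straddles FF x E F -> FF G -> G x -> F `<=` G.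
Proof.
case=> -[FE FF' EF imm] Fx nEx FG Gx.
have [//|GF] := member_total FF' FG.
have [EG|/(_ x Gx) //] := member_total FE FG.
by have [GE|->] := imm G FG EG GF; [rewrite GE in Gx|].
Qed.

Lemma straddles_nmem x E F G : straddles FF x E F -> FF G -> ~ G x -> G `<=` E.
Proof.
case=> -[FE FF' EF imm] Fx nEx FG nGx.
have [/(_ x Fx) //|GF] := member_total FF' FG.
have [EG|//] := member_total FE FG.
by have [->|GF'] := imm G FG EG GF; [|rewrite GF' in nGx].
Qed.

Lemma straddles_uniq x E F E' F' :
  straddles FF x E F -> straddles FF x E' F' -> E = E' /\ F = F'.
Proof.
move=> h h'; split; apply/seteqP; split.
- by apply: (straddles_nmem h' (straddles_memE h)); case: h.
- by apply: (straddles_nmem h (straddles_memE h')); case: h'.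
- by apply: (straddles_mem h (straddles_memF h')); case: h'.
- by apply: (straddles_mem h' (straddles_memF h)); case: h.
Qed.

End GeneralizedFlag.

(** * Members of a self-taut flag, their closures and complements *)

Section SelfTaut.
Variable FF : set (set V).
Hypothesis hFF : self_taut B FF.

Let gFF : generalized_flag FF. Proof. by case: hFF. Qed.

Lemma straddles_closure x E F : straddles FF x E F ->
  orth_closure B E = E \/ orth_closure B E = F.
Proof. by case: hFF => _ h _ []; move=> /h. Qed.

Lemma straddles_closure_sub x E F : straddles FF x E F -> orth_closure B E `<=` F.
Proof.
by move=> h; have [->|->] := straddles_closure h; [exact: straddles_sub h|].
Qed.

(** Let (E, F) be the pair around some y in cl G \ G. If E had a vector z outside G, the upper
    member at z would contain cl G and lie in E, which misses y. So E = G, and semiclosedness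
    identifies F. *)
Lemma nonclosed_pair G : FF G -> orth_closure B G <> G ->
  immediate_pair FF G (orth_closure B G).
Proof.
move=> hG nG.
have [y cy nGy] : exists2 y, orth_closure B G y & ~ G y.
  apply: contrapT => h; apply: nG; apply/seteqP; split; last exact: sub_closure.
  by move=> y cy; apply: contrapT => nGy; apply: h; exists y.
have y0 : y <> 0 by move=> y0; apply: nGy; rewrite y0; case: (member_subspace gFF hG).
have [E [F h]] := straddles_ex gFF y0.
have GE := straddles_nmem gFF h hG nGy.
have EG : E `<=` G.
  move=> z Ez; apply: contrapT => nGz.
  have z0 : z <> 0 by move=> z0; apply: nGz; rewrite z0; case: (member_subspace gFF hG).
  have [E2 [F2 h2]] := straddles_ex gFF z0.
  have GE2 := straddles_nmem gFF h2 hG nGz.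
  have F2E := straddles_mem gFF h2 (straddles_memE h) Ez.
  by case: h => _ _; apply; apply: F2E; apply: (straddles_closure_sub h2); exact: closureS cy.
have EG' : E = G by apply/seteqP.
rewrite EG' in h; have [cG|->] := straddles_closure h; last by case: h.
by case: nGy; rewrite -cG.
Qed.

(** Some z of E lies outside K; the lower member at z contains K, so the upper one absorbs cl K and
    is still inside E. *)
Lemma closure_strict x E F y D K :
  straddles FF x E F -> straddles FF y D K -> E y -> K <> E -> orth_closure B K `<=` E.
Proof.
move=> h hy Ey KE.
have KsE := straddles_mem gFF hy (straddles_memE h) Ey.
have [z Ez nKz] : exists2 z, E z & ~ K z.
  apply: contrapT => hn; apply: KE; apply/seteqP; split=> // z Ez.
  by apply: contrapT => nKz; apply: hn; exists z.
have z0 : z <> 0.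
  by move=> z0; apply: nKz; rewrite z0; case: (member_subspace gFF (straddles_memF hy)).
have [E2 [F2 h2]] := straddles_ex gFF z0.
have KE2 := straddles_nmem gFF h2 (straddles_memF hy) nKz.
apply: subset_trans (straddles_mem gFF h2 (straddles_memE h) Ez).
exact: subset_trans (closureS KE2) (straddles_closure_sub h2).
Qed.

Definition rank_one u v : V -> V := fun x => B x v *: u.

Lemma rank_one_stabilizer x E F u v : straddles FF x E F -> F u -> orth B E v ->
  stabilizer (gl_infty B) FF (rank_one u v).
Proof.
move=> h Fu Ev; split; first by apply: sub_lspan; exists u, v.
move=> G hG g Gg; rewrite /rank_one.
have [Gx|nGx] := pselect (G x).
  apply: (subspaceZ _ (member_subspace gFF hG)).
  exact: (straddles_mem gFF h hG Gx).
rewrite formC Ev ?scale0r; last exact: (straddles_nmem gFF h hG nGx).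
by case: (member_subspace gFF hG).
Qed.

(** Rank-one operators carry x to every vector of F when x is outside cl E. If E is dense in F, they
    reach the pairs below E instead, so U contains E and, being closed, F. *)
Lemma closed_stable_mem U : subspace U -> orth_closure B U = U ->
  (forall X, stabilizer (gl_infty B) FF X -> stable X U) ->
  forall x E F, straddles FF x E F -> U x -> F `<=` U.
Proof.
move=> hU cU sU x E F h Ux.
have key y D K : straddles FF y D K -> K `<=` F -> ~ orth_closure B D x -> K `<=` U.
  move=> hy KF nDx u Ku.
  have [v Dv xv] := separate_closed (orth_closed (orth B D)) nDx.
  have -> : u = rank_one u v x by rewrite /rank_one xv scale1r.
  apply: (sU) => //; apply: rank_one_stabilizer hy Ku _.
  by rewrite -(orth_closed D).
have [cE|cE] := straddles_closure h; first by apply: (key _ _ _ h) => //; rewrite cE; case: h.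
have EU : E `<=` U.
  move=> y Ey; have [->|/eqP y0] := eqVneq y 0; first by case: hU.
  have [D [K hy]] := straddles_ex gFF y0.
  have KE := straddles_mem gFF hy (straddles_memE h) Ey.
  have Ky : K y by case: hy.
  apply: (key _ _ _ hy _ _ _ Ky).
    by rewrite -cE; apply: subset_trans KE _; exact: sub_closure.
  by move=> /(straddles_closure_sub hy)/KE; case: h.
by rewrite -cE -cU; exact: closureS.
Qed.

(** With [orth_nmem], this is the usable form of self-tautness: G^perp need not belong to the flag,
    yet it never cuts strictly inside an immediate pair. *)
Lemma orth_mem x E F G : straddles FF x E F -> FF G ->
  orth B G x -> F `<=` orth B G.
Proof.
move=> h hG; apply: closed_stable_mem h.
- exact: orth_subspace.
- exact: orth_closed.
- by case: hFF => _ _ hs X; exact: hs.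
Qed.

Lemma orth_nmem x E F G : straddles FF x E F -> FF G ->
  ~ orth B G x -> orth B G `<=` E.
Proof.
move=> h hG nGx y Gy; apply: contrapT => nEy.
have y0 : y <> 0.
  by move=> y0; apply: nEy; rewrite y0; case: (member_subspace gFF (straddles_memE h)).
have [D [K hy]] := straddles_ex gFF y0.
have [EK _] := (straddles_nmem gFF hy (straddles_memE h) nEy, I).
have KG := orth_mem hy hG Gy.
apply: nGx; apply: KG.
have [//|nKx] := pselect (K x).
have := straddles_nmem gFF h (straddles_memF hy) nKx.
by case: hy => _ Ky nDy /(_ _ Ky).
Qed.

End SelfTaut.

(** * Stabilizers and their nilpotent ideals *)

Definition wedge u v : V -> V := fun x => B x v *: u - B x u *: v.

(** Operators are bare functions; skewness with respect to a nondegenerate form already makes them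
    linear. *)
Definition skew (X : V -> V) := forall x y, B (X x) y = - B x (X y).

Lemma wedge_so u v : so_infty B (wedge u v).
Proof. by apply: sub_lspan; exists u, v. Qed.

Lemma so_subspace : subspace (so_infty B).
Proof. exact: lspan_subspace. Qed.

Lemma so_skew X : so_infty B X -> skew X.
Proof.
apply: (@lspan_sub _ (V -> V : lmodType R[i]) _ [set X | skew X]).
  split=> [x y|a Y Z hY hZ x y]; first by rewrite !formE oppr0.
  rewrite !fctE !formE hY hZ; ring.
by move=> _ [u [v ->]] x y; rewrite !formE !(formC _ y); ring.
Qed.

Lemma skew0 X : skew X -> X 0 = 0.
Proof. by move=> hX; apply: form_ext => w; rewrite hX !formE oppr0. Qed.

Lemma skewZ X a x : skew X -> X (a *: x) = a *: X x.
Proof. by move=> hX; apply: form_ext => w; rewrite !(formE, hX); ring. Qed.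

Lemma skewD X x y : skew X -> X (x + y) = X x + X y.
Proof. by move=> hX; apply: form_ext => w; rewrite !(formE, hX); ring. Qed.

Lemma stable_orth X F : skew X -> stable X F -> stable X (orth B F).
Proof. by move=> hX sX x hx y Fy; rewrite hX hx ?oppr0 //; exact: sX. Qed.

Lemma lie_wedge X u v : skew X -> lie X (wedge u v) = wedge (X u) v + wedge u (X v).
Proof.
move=> hX; apply/funext => x; apply: form_ext => w.
rewrite /lie /wedge !fctE !(formE, hX); ring.
Qed.

(* Finite-rank operators factor through finitely many functionals B _ v. *)
Lemma so_closure X E x : so_infty B X -> subspace E -> orth_closure B E x ->
  exists2 y, E y & X x = X y.
Proof.
move=> soX hE cx.
suff [s hs] : exists s : seq V,
    forall x y, (forall v, v \in s -> B x v = B y v) -> X x = X y.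
  by have [y Ey /hs xy] := closure_approx s hE cx; exists y.
move: X soX; apply: (@lspan_sub _ (V -> V : lmodType R[i]) _ [set X | exists s : seq V,
    forall x y, (forall v, v \in s -> B x v = B y v) -> X x = X y]).
  split=> [|a Y Z [s hs] [t ht]]; first by exists [::].
  exists (s ++ t) => y z yz; rewrite !fctE (hs y z) ?(ht y z) // => v vs.
    by apply: yz; rewrite mem_cat vs orbT.
  by apply: yz; rewrite mem_cat vs.
move=> _ [u [v ->]]; exists [:: u; v] => y z yz.
by rewrite !yz // !inE eqxx ?orbT.
Qed.

Section Stabilizer.
Variable FF : set (set V).
Hypothesis gFF : generalized_flag FF.
Let s := stabilizer (so_infty B) FF.
Implicit Types (X Y : V -> V).

Lemma stabilizer_skew X : s X -> skew X.
Proof. by case=> /so_skew. Qed.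

Lemma stabilizer_subspace : subspace s.
Proof.
split=> [|a X Y [soX sX] [soY sY]].
  by split=> [|F hF x Fx]; [exact: subspace0 so_subspace|case: (member_subspace gFF hF)].
split; first by apply: so_subspace.2.
move=> F hF x Fx; have hsF := member_subspace gFF hF.
by apply: (subspaceD hsF); [apply: (subspaceZ _ hsF); exact: sX | exact: sY].
Qed.

(** The trace conditions with the homomorphisms forgotten; the flag enters only through its
    stabilizer. *)
Definition between p :=
  [/\ subspace p, p `<=` s, linear_nilradical s `<=` p & derived s `<=` p].

(* Operators V -> H^perp -> H -> 0: a nilpotent ideal of the stabilizer. *)
Definition nil_ideal H : set (V -> V) := [set X | [/\ s X,
  forall x, orth B H (X x), forall x, orth B H x -> H (X x) &
  forall x, H x -> X x = 0]].

Lemma nil_ideal_subspace H : subspace H -> subspace (nil_ideal H).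
Proof.
move=> hH; have hO := orth_subspace H; split=> [|a X Y [sX X1 X2 X3] [sY Y1 Y2 Y3]].
  split=> //; [exact: subspace0 stabilizer_subspace|move=> x|move=> x _].
    exact: (subspace0 hO).
  exact: (subspace0 hH).
split; first by apply: stabilizer_subspace.2.
- by move=> x; rewrite !fctE; apply: hO.2.
- by move=> x hx; rewrite !fctE; apply: hH.2; [exact: X2|exact: Y2].
- by move=> x hx; rewrite !fctE X3 // Y3 // scaler0 addr0.
Qed.

Lemma lie_stabilizer X Y : s X -> s Y -> s (lie X Y).
Proof.
move=> sX sY; have [soX hX] := sX; have [soY hY] := sY; split; last first.
  move=> F hF x Fx; apply: (subspaceB (member_subspace gFF hF)).
    by apply: hX => //; exact: hY.
  by apply: hY => //; exact: hX.
have kX := so_skew soX.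
move: Y soY {sY hY}; apply: (@lspan_sub _ (V -> V : lmodType R[i]) _
    [set Y | so_infty B (lie X Y)]).
  split=> [|a Y Z hY hZ].
    rewrite /= (_ : lie X 0 = 0); first by exact: subspace0 so_subspace.
    by apply/funext => x; rewrite /lie skew0 // subrr.
  rewrite /= (_ : lie X (a *: Y + Z) = a *: lie X Y + lie X Z).
    by apply: so_subspace.2.
  apply/funext => x; apply: form_ext => w.
  by rewrite /lie !fctE !(formE, kX); ring.
move=> _ [u [v ->]]; rewrite /= -/(wedge u v) lie_wedge //.
by apply: (subspaceD so_subspace); exact: wedge_so.
Qed.

Lemma nil_ideal_lie H X Y : subspace H -> (forall Z, s Z -> stable Z H) ->
  s X -> nil_ideal H Y -> nil_ideal H (lie X Y).
Proof.
move=> hH sH sX [sY Y1 Y2 Y3]; have hO := orth_subspace H.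
have XH := sH _ sX; have XO := stable_orth (stabilizer_skew sX) XH.
split; first exact: lie_stabilizer.
- by move=> x; apply: (subspaceB hO); [apply: XO|]; exact: Y1.
- by move=> x Hx; apply: (subspaceB hH); [apply: XH|]; apply: Y2 => //; exact: XO.
- by move=> x Hx; rewrite /lie !Y3 ?(skew0 (stabilizer_skew sX)) ?subrr //; exact: XH.
Qed.

(** Commutators in [nil_ideal H] map V into H and kill H^perp, which contains H; hence they commute,
    and the ideal is solvable. Its elements have cube zero. *)
Lemma nil_ideal_nilradical H : isotropic B H -> (forall Z, s Z -> stable Z H) ->
  nil_ideal H `<=` linear_nilradical s.
Proof.
move=> [hH HO] sH X nX; split; last first.
  exists 3%N => v; case: nX => _ X1 X2 X3 /=.
  by rewrite X3 //; apply: X2; exact: X1.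
have hN := nil_ideal_subspace hH.
have sub : nil_ideal H `<=` s by move=> Y [].
apply: sub_lspan; exists (nil_ideal H); split=> //.
  by split=> // Y Z sY nZ; exact: nil_ideal_lie.
move=> A _ AN; exists (nil_ideal H); split=> //.
  by split=> // Y Z nY nZ; apply: nil_ideal_lie => //; exact: sub.
exists 2%N; rewrite /=.
have d1 : derived (nil_ideal H) `<=`
    [set Y | (forall x, H (Y x)) /\ forall x, orth B H x -> Y x = 0].
  apply: lspan_sub; first split=> [|a Y Z [Y1 Y2] [Z1 Z2]].
  - by split=> // x; exact: (subspace0 hH).
  - split=> x; rewrite !fctE; first by apply: hH.2.
    by move=> hx; rewrite Y2 // Z2 // scaler0 addr0.
  - move=> _ [Y [Z [[sY Y1 Y2 Y3] [sZ Z1 Z2 Z3] ->]]]; split=> x.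
      by apply: (subspaceB hH); [apply: Y2; exact: Z1|apply: Z2; exact: Y1].
    by move=> hx; rewrite /lie (Y3 _ (Z2 _ hx)) (Z3 _ (Y2 _ hx)) subrr.
apply/seteqP; split; last by move=> _ ->; exact: (subspace0 (lspan_subspace _)).
apply: lspan_sub.
  by split=> [//|a Y Z -> ->]; rewrite /= scaler0 addr0.
move=> _ [Y [Z [/d1[Y1 Y2] /d1[Z1 Z2] ->]]].
by apply/funext => x; rewrite /lie (Y2 _ (HO _ (Z1 x))) (Z2 _ (HO _ (Y1 x))) subrr.
Qed.

Lemma derived_lie X Y : s X -> s Y -> derived s (lie X Y).
Proof. by move=> sX sY; apply: sub_lspan; exists X, Y. Qed.

Lemma wedge_stabilizer u v :
  (forall G g, FF G -> G g -> G (B g v *: u - B g u *: v)) -> s (wedge u v).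
Proof. by move=> h; split=> [|G hG g Gg]; [exact: wedge_so|exact: h]. Qed.

Lemma wedge_nilradical H u v : isotropic B H -> (forall Z, s Z -> stable Z H) ->
  H u -> orth B H v -> s (wedge u v) -> linear_nilradical s (wedge u v).
Proof.
move=> iH sH Hu Hv suv; apply: nil_ideal_nilradical (iH) sH _ _.
have [hH HO] := iH; have hO := orth_subspace H.
split=> // x; rewrite /wedge.
- by apply: (subspaceB hO); apply: (subspaceZ _ hO) => //; exact: HO.
- by move=> Hx; rewrite (Hx _ Hu) scale0r subr0; exact: (subspaceZ _ hH).
- by move=> Hx; rewrite (formC x v) (Hv _ Hx) (HO _ Hx _ Hu) !scale0r subr0.
Qed.

End Stabilizer.

(** * Elements u /\ v of the stabilizer and of p *)

Section TraceConditions.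
Variables (FF : set (set V)) (p : set (V -> V)).
Hypotheses (hFF : self_taut B FF) (hp : between FF p).
Let gFF : generalized_flag FF. Proof. by case: hFF. Qed.
Let s := stabilizer (so_infty B) FF.
Let sp : subspace p. Proof. by case: hp. Qed.

Lemma nilradical_p X : linear_nilradical s X -> p X.
Proof. by case: hp => _ _ h _; exact: h. Qed.

Lemma lie_p X Y : s X -> s Y -> p (lie X Y).
Proof. by case: hp => _ _ _ h sX sY; apply: h; exact: derived_lie. Qed.

(** Only the term B g u v could leave a member G containing H. If g is not orthogonal to H,
    self-tautness puts H^perp, hence v, below g and so in G. *)
Lemma wedge_isotropic H u v : FF H -> H `<=` orth B H -> H u -> orth B H v ->
  p (wedge u v).
Proof.
move=> hH iH Hu Hv; have sH := member_subspace gFF hH.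
apply: nilradical_p; apply: (wedge_nilradical gFF (H := H)) => //.
  by move=> Z [_]; apply.
apply: wedge_stabilizer => G g hG Gg; have sG := member_subspace gFF hG.
have [HG|GH] := member_total gFF hH hG; last first.
  by rewrite formC (Hv _ (GH _ Gg)) (iH _ (GH _ Gg) _ Hu) !scale0r subr0; exact: subspace0.
have Gu := HG _ Hu.
apply: (subspaceB sG); first exact: (subspaceZ _ sG).
have [Hg|nHg] := pselect (orth B H g); first by rewrite Hg // scale0r; exact: subspace0.
have g0 : g <> 0 by move=> g0; apply: nHg; rewrite g0; case: (orth_subspace H).
have [E [F h]] := straddles_ex gFF g0.
apply: (subspaceZ _ sG); apply: (straddles_mem gFF h hG Gg).
by apply: (straddles_sub h); exact: (orth_nmem hFF h hH nHg).
Qed.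

(** The nilpotent ideal is that of K^perp, which need not be a member but is stable by skewness. *)
Lemma wedge_coisotropic K u v : FF K -> orth B K `<=` K -> orth B K u -> K v ->
  p (wedge u v).
Proof.
move=> hK cK Ku Kv; have sK := member_subspace gFF hK.
apply: nilradical_p; apply: (wedge_nilradical gFF (H := orth B K)) => //.
- by split; [exact: orth_subspace|exact: orthS].
- by move=> Z sZ; apply: stable_orth (stabilizer_skew sZ) _; case: sZ => _; apply.
- exact: sub_closure.
apply: wedge_stabilizer => G g hG Gg; have sG := member_subspace gFF hG.
have [KG|GK] := member_total gFF hK hG.
  by apply: (subspaceB sG); apply: (subspaceZ _ sG); apply: KG => //; exact: cK.
rewrite [B g u]formC (Ku _ (GK _ Gg)) scale0r subr0.
have [Gu|nGu] := pselect (G u); first exact: (subspaceZ _ sG).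
have [Gv|nGv] := pselect (orth B G v).
  by rewrite formC Gv // scale0r; exact: subspace0.
have v0 : v <> 0 by move=> v0; apply: nGv; rewrite v0; case: (orth_subspace G).
have [E [F h]] := straddles_ex gFF v0.
have GE := orth_nmem hFF h hG nGv.
have EK := subset_trans (straddles_sub h) (straddles_mem gFF h hK Kv).
(* So u is in cl G \ G. Then K^perp, which contains u, contains cl G; thus K is orthogonal to G and
   v falls into E, a contradiction. *)
have cGu : orth_closure B G u by apply: (orthS GE); exact: (orthS EK).
have nG : orth_closure B G <> G by move=> cG; apply: nGu; rewrite -cG.
have hu : straddles FF u G (orth_closure B G) by split=> //; exact: nonclosed_pair.
case: h => _ _ []; apply: GE; rewrite -(orth_closed G).
by apply: (orthS (orth_mem hFF hu hK Ku)); exact: sub_closure.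
Qed.

(* E^perp may contain a dense member G, and then only v in G are allowed. *)
Lemma wedge_pair x E F u v : straddles FF x E F -> F u -> orth B E v ->
    (forall G, FF G -> orth_closure B G <> G -> orth_closure B G = orth B E -> G v) ->
  s (wedge u v).
Proof.
move=> h Fu Ev hv; apply: wedge_stabilizer => G g hG Gg.
have sG := member_subspace gFF hG.
apply: (subspaceB sG).
  have [Gx|nGx] := pselect (G x).
    by apply: (subspaceZ _ sG); exact: (straddles_mem gFF h hG Gx).
  rewrite formC (Ev _ (straddles_nmem gFF h hG nGx Gg)) scale0r; exact: subspace0.
have [Gx|nGx] := pselect (orth B G x).
  rewrite formC (orth_mem hFF h hG Gx Fu Gg) scale0r; exact: subspace0.
apply: (subspaceZ _ sG); apply: contrapT => nGv.
have EG := orthS (orth_nmem hFF h hG nGx); have cGv := EG _ Ev.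
have nG : orth_closure B G <> G by move=> cG; apply: nGv; rewrite -cG.
have hvG : straddles FF v G (orth_closure B G) by split=> //; exact: nonclosed_pair.
apply: nGv; apply: hv => //; apply/seteqP; split=> //.
exact: (orth_mem hFF hvG (straddles_memE h)).
Qed.

(** If E^perp has a dense member G, v is moved into G without changing its pairings with the
    finitely many vectors that a computation involves. *)
Lemma wedge_pair_approx x E F v (l : seq V) : straddles FF x E F -> orth B E v ->
  exists v', [/\ orth B E v', forall z, z \in l -> B z v' = B z v &
                 forall u, F u -> s (wedge u v')].
Proof.
move=> h Ev.
have [[G [hG nG GE]]|hn] := pselect (exists G,
    [/\ FF G, orth_closure B G <> G & orth_closure B G = orth B E]); last first.
  exists v; split=> // u Fu; apply: (wedge_pair h Fu Ev) => G hG nG GE.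
  by case: hn; exists G.
have [v' Gv' hv'] : exists2 v', G v' & forall z, z \in l -> B v z = B v' z.
  by apply: (closure_approx l (member_subspace gFF hG)); rewrite GE.
have Ev' : orth B E v' by rewrite -GE; exact: sub_closure.
exists v'; split=> // [z /hv'|u Fu]; first by rewrite !(formC z).
apply: (wedge_pair h Fu Ev') => G' hG' nG' G'E.
(* Every other dense member G' contains v' as well: otherwise G would contain cl G' = E^perp and be
   closed. *)
apply: contrapT => nGv'.
have h' : straddles FF v' G' (orth_closure B G').
  split=> //; first exact: nonclosed_pair.
  by rewrite G'E.
apply: nG; apply/seteqP; split; last exact: sub_closure.
by rewrite GE -G'E; exact: (straddles_mem gFF h' hG Gv').
Qed.

(** On F / E, z /\ v is an elementary matrix of sl, the commutator of z /\ w and x /\ v with B x w =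
    1. The form adds two terms: in each alternative one vanishes and the other is in the
    nilradical. *)
Lemma wedge_sl x E F z t : straddles FF x E F -> orth_closure B E = E ->
    F `<=` orth B F \/ orth B E `<=` E -> F z -> ~ add_line E z t ->
  exists v, [/\ orth B E v, B z v = 0, B t v = 1 & p (wedge z v)].
Proof.
move=> h cE hEF Fz nt; have sE := member_subspace gFF (straddles_memE h).
have [Fx nEx] : F x /\ ~ E x by case: h.
rewrite -{1}cE in nt.
have [v0 [Ev0 zv0 tv0]] := separate_line (orth_subspace E) nt.
have [v [Ev hv sv]] := wedge_pair_approx [:: z; t] h Ev0.
have zv : B z v = 0 by rewrite hv // inE eqxx.
have tv : B t v = 1 by rewrite hv // !inE eqxx orbT.
exists v; split=> //.
have [w0 Ew0 xw0] := separate_closed cE nEx.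
have [w [Ew hw sw]] := wedge_pair_approx [:: x] h Ew0.
have xw : B x w = 1 by rewrite hw // inE eqxx.
have -> : wedge z v = lie (wedge z w) (wedge x v) +
    (B x z *: wedge w v - B v w *: wedge x z).
  rewrite (lie_wedge _ _ (so_skew (wedge_so _ _))).
  apply/funext => y; apply: form_ext => q.
  by rewrite !fctE /wedge !formE (formC v z) zv xw; ring.
apply: (subspaceD sp); first by apply: lie_p; [exact: sw|exact: sv].
case: hEF => [iF|cEE].
  rewrite (iF _ Fx _ Fz) scale0r sub0r; apply: (subspaceN sp); apply: (subspaceZ _ sp).
  by apply: (wedge_isotropic (straddles_memF h)) => //; exact: iF.
rewrite (Ev _ (cEE _ Ew)) scale0r subr0; apply: (subspaceZ _ sp).
by apply: (wedge_coisotropic (straddles_memE h)) => //; exact: cEE.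
Qed.

(** z /\ v is the commutator of z /\ w and a /\ v. For z, v independent modulo E such w and a cannot
    exist in dimension two: w, orthogonal to v, would be a multiple of z modulo E. *)
Lemma wedge_so_block x E F z v w (a : V) : straddles FF x E F -> E = orth B F ->
    F `<=` orth B E -> F z -> F v -> F w -> F a ->
    B a w = 1 -> B a z = 0 -> B v w = 0 -> B v z = 0 ->
  p (wedge z v).
Proof.
move=> h EF FE Fz Fv Fw Fa aw az vw vz.
have sF u u' : F u -> F u' -> s (wedge u u').
  move=> Fu Fu'; apply: wedge_stabilizer => G g hG Gg.
  have sG := member_subspace gFF hG.
  have [Gx|nGx] := pselect (G x).
    have FG := straddles_mem gFF h hG Gx.
    by apply: (subspaceB sG); apply: (subspaceZ _ sG); exact: FG.
  have := straddles_nmem gFF h hG nGx Gg; rewrite EF => Fg.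
  by rewrite !Fg // !scale0r subr0; exact: subspace0.
have <- : lie (wedge z w) (wedge a v) = wedge z v; last by apply: lie_p; exact: sF.
rewrite (lie_wedge _ _ (so_skew (wedge_so _ _))).
apply/funext => y; apply: form_ext => q.
by rewrite !fctE /wedge !formE aw az vw vz; ring.
Qed.

End TraceConditions.

(** * Subspaces stable under p *)

Lemma kernel_line F v : subspace F ->
  exists2 q, F q & F `<=` add_line [set y | F y /\ B y v = 0] q.
Proof.
move=> hF; have [Fv|/(not_orth hF)[q Fq vq]] := pselect (orth B F v).
  exists 0; first exact: subspace0.
  by move=> y Fy; apply: sub_add_line; split=> //; rewrite formC; exact: Fv.
exists q => // y Fy; exists (B y v); split.
  by apply: (subspaceB hF) => //; exact: (subspaceZ _ hF).
by rewrite !formE (formC q) vq mulr1 subrr.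
Qed.

Lemma generic_orth F U n v : subspace F ->
    (forall q r, F q -> F r -> ~ F `<=` add_line (add_line U q) r) ->
  exists w, [/\ F w, ~ U w, B w n = 0 & B w v = 0].
Proof.
move=> hF big; apply: contrapT => hn.
have [r Fr Fr'] := kernel_line n hF.
have [q [Fq _] Fq'] := kernel_line v (kernel_subspace n hF).
apply: (big q r Fq Fr); apply: (subset_trans Fr'); apply: add_lineS.
apply: (subset_trans Fq'); apply: add_lineS => w [[Fw wn] wv].
by apply: contrapT => nUw; apply: hn; exists w.
Qed.

Section Submodule.
Variables (FF : set (set V)) (p : set (V -> V)).
Hypotheses (hFF : self_taut B FF) (hp : between FF p).
Let gFF : generalized_flag FF. Proof. by case: hFF. Qed.

(* Over such x the stabilizer acts through so(2), hence not irreducibly. *)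
Definition exceptional x :=
  exists L, [/\ hyperbolic_plane_member B FF L, orth B L x & ~ L x].

Variable N : set V.
Hypotheses (sN : subspace N) (pN : forall X, p X -> stable X N).

Lemma wedge_submod u v x : p (wedge u v) -> N x -> N (B x v *: u - B x u *: v).
Proof. by move=> puv Nx; exact: (pN puv). Qed.

(** (z /\ v) x = z - B x z v, and the second term vanishes or lies in E^perp, which is then inside
    E. *)
Lemma submod_above_pair x E F : straddles FF x E F -> orth_closure B E = E ->
  F `<=` orth B F \/ orth B E `<=` E -> N x -> E `<=` N -> F `<=` N.
Proof.
move=> h cE hEF Nx EN z Fz; have sE := member_subspace gFF (straddles_memE h).
have [Fx nEx] : F x /\ ~ E x by case: h.
have [xz|nxz] := pselect (add_line E z x).
  by apply: (add_line_min sN EN Nx); exact: add_line_exchange.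
have [v [Ev zv xv pv]] := wedge_sl hFF hp h cE hEF Fz nxz.
have := wedge_submod pv Nx; rewrite xv scale1r.
case: hEF => [iF|cEE]; first by rewrite (iF _ Fx _ Fz) scale0r subr0.
by move/(subspaceBK sN); apply; apply: (subspaceZ _ sN); apply: EN; exact: cEE.
Qed.

Lemma submod_isotropic_member K y x : FF K -> K `<=` orth B K -> K y ->
  ~ orth_closure B K x -> B x y = 0 -> N x -> N y.
Proof.
move=> hK iK Ky /(not_orth (orth_subspace K))[v Kv xv] xy Nx.
have := wedge_submod (wedge_isotropic hFF hp hK iK Ky Kv) Nx.
by rewrite xv xy scale1r scale0r subr0.
Qed.

Lemma submod_coisotropic_kernel K y x : FF K -> orth B K `<=` K -> ~ orth_closure B K x ->
  N x -> K y -> B x y = 0 -> N y.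
Proof.
move=> hK cK /(not_orth (orth_subspace K))[v Kv xv] Nx Ky xy.
have := wedge_submod (wedge_coisotropic hFF hp hK cK Kv Ky) Nx.
by rewrite xv xy scale1r scale0r sub0r => /(subspaceN sN); rewrite opprK.
Qed.

(** The kernel lemma reaches only the vectors of K orthogonal to x. The missing direction v, with B
    x v = 1, is reached from a vector t of that kernel not orthogonal to K; it exists because K is
    not isotropic. *)
Lemma submod_coisotropic_member K x : FF K -> orth B K `<=` K -> ~ K `<=` orth B K ->
  ~ orth_closure B K x -> N x -> K `<=` N.
Proof.
move=> hK cK nK nx Nx; have sK := member_subspace gFF hK.
have [v Kv xv] := not_orth (orth_subspace K) nx.
have key y : K y -> K (y - B x y *: v) /\ B x (y - B x y *: v) = 0.
  move=> Ky; split; first by apply: (subspaceB sK) => //; apply: (subspaceZ _ sK); exact: cK.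
  by rewrite !formE xv; ring.
have [t [Kt xt nt]] : exists t, [/\ K t, B x t = 0 & ~ orth B K t].
  apply: contrapT => hn; apply: nK => y Ky; have [Ky' xy'] := key _ Ky.
  apply: (@subspaceBK _ _ _ _ (B x y *: v) (orth_subspace K)).
    by apply: contrapT => ny; apply: hn; exists (y - B x y *: v).
  exact: (subspaceZ _ (orth_subspace K)).
have Nt := submod_coisotropic_kernel hK cK nx Nx Kt xt.
have [y Ky ty] := not_orth sK nt.
have Nv : N v.
  have := wedge_submod (wedge_coisotropic hFF hp hK cK Kv Ky) Nt.
  by rewrite ty (formC t v) (Kv _ Kt) scale1r scale0r subr0.
move=> z /key[Kz xz]; apply: (subspaceBK sN (submod_coisotropic_kernel hK cK nx Nx Kz xz)).
exact: (subspaceZ _ sN).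
Qed.

Lemma submod_isotropic_pair x E F : straddles FF x E F -> orth_closure B E = E ->
  F `<=` orth B F -> N x -> E `<=` N.
Proof.
move=> h cE iF Nx y Ey; have [->|/eqP y0] := eqVneq y 0; first exact: subspace0.
have [D [K hy]] := straddles_ex gFF y0.
have KE := straddles_mem gFF hy (straddles_memE h) Ey.
have KF := subset_trans KE (straddles_sub h).
have [Fx nEx] : F x /\ ~ E x by case: h.
have Ky : K y by case: hy.
apply: (submod_isotropic_member (straddles_memF hy) _ Ky _ (iF _ Fx _ (KF _ Ky)) Nx).
  by apply: (subset_trans KF); apply: (subset_trans iF); exact: orthS.
by move=> /(closureS KE); rewrite cE.
Qed.

(** No vector of E pairs with E, so the missing direction v of E is reached from outside: z /\ v
    moves x to a vector t of N outside E and orthogonal to v, and the kernel lemma at t yields v. *)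
Lemma submod_maximal_isotropic x E F z : straddles FF x E F -> E = orth B E ->
  F z -> ~ add_line E x z -> N x -> E `<=` N.
Proof.
move=> h EE Fz nz Nx; have sE := member_subspace gFF (straddles_memE h).
have [Fx nEx] : F x /\ ~ E x by case: h.
have cE : orth_closure B E = E by rewrite /orth_closure -!EE.
have cEE : orth B E `<=` E by rewrite -EE.
have nEz : ~ E z by move=> Ez; apply: nz; exact: sub_add_line.
have nxz : ~ add_line E z x by move=> xz; apply: nz; exact: add_line_exchange.
have [v [Ev zv xv pv]] := wedge_sl hFF hp h cE (or_intror cEE) Fz nxz.
have := wedge_submod pv Nx; rewrite xv scale1r; set t := (_ - _) => Nt.
have nEt : ~ orth_closure B E t.
  rewrite cE => Et; apply: nEz; apply: (subspaceBK sE Et).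
  by apply: (subspaceZ _ sE); exact: cEE.
have Nv : N v.
  apply: (submod_coisotropic_kernel (straddles_memE h) cEE nEt Nt); first exact: cEE.
  by rewrite /t !formE zv (Ev _ (cEE _ Ev)); ring.
move=> y Ey; apply: (@subspaceBK _ _ _ _ (B x y *: v) sN); last exact: (subspaceZ _ sN).
apply: (submod_coisotropic_kernel (straddles_memE h) cEE _ Nx).
- by rewrite cE.
- by apply: (subspaceB sE) => //; apply: (subspaceZ _ sE); exact: cEE.
- by rewrite !formE xv; ring.
Qed.

(** L = F^perp is the hyperplane of E orthogonal to x. It is a member because the lower member at v
    lies between L and E and misses v. So E is a maximal isotropic subspace over L, and F =
    L^perp. *)
Lemma maximal_isotropic_exceptional x E F : straddles FF x E F -> E = orth B E ->
  F `<=` add_line E x -> exceptional x /\ orth_closure B F = F.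
Proof.
move=> h EE Fl; have sE := member_subspace gFF (straddles_memE h).
have sF := member_subspace gFF (straddles_memF h).
have [Fx nEx] : F x /\ ~ E x by case: h.
have EF := straddles_sub h.
have cE : orth_closure B E = E by rewrite /orth_closure -!EE.
have iE u v : E u -> E v -> B u v = 0 by rewrite {1}EE; apply.
have FE : F = add_line E x by apply/seteqP; split=> //; exact: (add_line_min sF EF).
have cF : orth_closure B F = F by rewrite FE add_line_closed.
have LE : orth B F `<=` E by rewrite EE; exact: orthS.
have [v Ev xv] := separate_closed cE nEx; rewrite -EE in Ev.
have nLv : ~ orth B F v.
  by move=> /(_ _ Fx); rewrite formC xv => /eqP; rewrite oner_eq0.
have red e : E e -> orth B F (e - B x e *: v).
  move=> Ee f; rewrite FE => -[c fc].
  have ev : E (e - B x e *: v) by apply: (subspaceB sE) => //; exact: (subspaceZ _ sE).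
  have ex : B (e - B x e *: v) x = 0 by rewrite !formE (formC v) xv (formC e); ring.
  by rewrite -[f](subrK (c *: x)) formDr (iE _ _ ev fc) formZr ex mulr0 addr0.
have v0 : v <> 0 by move=> v0; apply: nLv; rewrite v0; case: (orth_subspace F).
have [D [K hv]] := straddles_ex gFF v0.
have LD := orth_nmem hFF hv (straddles_memF h) nLv.
have DE := subset_trans (straddles_sub hv) (straddles_mem gFF hv (straddles_memE h) Ev).
have DL : D `<=` orth B F.
  move=> e De; have sD := member_subspace gFF (straddles_memE hv).
  have := red _ (DE _ De); have [->|xe] := eqVneq (B x e) 0; first by rewrite scale0r subr0.
  move=> /LD/(subspaceB sD De); rewrite opprB addrC subrK => /(subspaceZK sD xe).
  by case: hv.
have FL : FF (orth B F).
  by rewrite (_ : orth B F = D); [exact: (straddles_memE hv)|apply/seteqP].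
split=> //; exists (orth B F); split; last 1 first.
- by move=> /LE.
- split=> //.
  + by split; [exact: orth_subspace|apply: orthS; exact: (subset_trans LE)].
  + exact: orth_closed.
  + have sL := orth_subspace F; have sLv := add_line_subspace v sL.
    rewrite -/(orth_closure B F) cF; apply: (@quot_dim2_lines _ _ _ _ v x) => //.
    * exact: (subset_trans LE).
    * exact: EF.
    * by move=> /(add_line_min sE LE Ev).
    * rewrite {1}FE; apply: add_lineS => e /red; by exists (B x e).
- exact: (sub_closure Fx).
Qed.

(** For v orthogonal to n, n /\ v sends n to - B n n v, and such v together with n span F. The
    dimension bound supplies the auxiliary w that makes n /\ v a commutator. *)
Lemma submod_anisotropic x E F n : straddles FF x E F -> E = orth B F ->
    F `<=` orth B E -> N n -> F n -> B n n != 0 -> 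
    (forall q r, F q -> F r -> ~ F `<=` add_line (add_line E q) r) -> F `<=` N.
Proof.
move=> h EF FE Nn Fn nn big; have sF := member_subspace gFF (straddles_memF h).
have key v : F v -> B v n = 0 -> N v.
  move=> Fv vn; have [w [Fw nEw wn wv]] := generic_orth n v sF big.
  rewrite EF in nEw; have [a0 Fa0 wa0] := not_orth sF nEw.
  (* Projecting off n keeps the pairing with w, which is orthogonal to n. *)
  pose a1 := a0 - (B a0 n / B n n) *: n.
  have Fa1 : F a1 by apply: (subspaceB sF) => //; exact: (subspaceZ _ sF).
  have pnv : p (wedge n v).
    apply: (wedge_so_block hFF hp h EF FE Fn Fv Fw Fa1) => //.
    - by rewrite !formE (formC a0) wa0 (formC n) wn; ring.
    - by rewrite !formE; field.
    - by rewrite formC.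
  have := wedge_submod pnv Nn; rewrite (formC n v) vn scale0r sub0r -scaleNr.
  by apply: (subspaceZK sN); rewrite oppr_eq0.
move=> v Fv; apply: (@subspaceBK _ _ _ _ ((B v n / B n n) *: n) sN).
  apply: key; first by apply: (subspaceB sF) => //; exact: (subspaceZ _ sF).
  by rewrite !formE; field.
exact: (subspaceZ _ sN).
Qed.

(** An isotropic x is first traded for an anisotropic n: with f a hyperbolic partner of x, and n
    orthogonal to both, f /\ n sends x to - n. *)
Lemma submod_so_block x E F : straddles FF x E F -> E = orth B F ->
    F `<=` orth B E -> N x ->
    (forall q r, F q -> F r -> ~ F `<=` add_line (add_line E q) r) -> F `<=` N.
Proof.
move=> h EF FE Nx big; have sF := member_subspace gFF (straddles_memF h).
have [Fx nEx] : F x /\ ~ E x by case: h.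
have [xx|xx] := eqVneq (B x x) 0; last exact: (submod_anisotropic h EF FE Nx).
have half : (2 : R[i]) != 0 by rewrite pnatr_eq0.
have [f0 Ff0 xf0] : exists2 f, F f & B x f = 1 by apply: not_orth; rewrite -?EF.
pose f := f0 - (B f0 f0 / 2) *: x.
have Ff : F f by apply: (subspaceB sF) => //; exact: (subspaceZ _ sF).
have xf : B x f = 1 by rewrite !formE xx xf0; ring.
have ff : B f f = 0 by rewrite !formE (formC f0 x) xx xf0; field.
clearbody f.
have [n [Fn nx nf nn]] : exists n, [/\ F n, B n x = 0, B n f = 0 & B n n != 0].
  have [w [Fw nEw wx wf]] := generic_orth x f sF big.
  have [ww|ww] := eqVneq (B w w) 0; last by exists w.
  rewrite EF in nEw; have [u0 Fu0 wu0] := not_orth sF nEw.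
  pose u := u0 - B u0 f *: x - B u0 x *: f.
  have Fu : F u.
    by apply: (subspaceB sF); [apply: (subspaceB sF)|] => //; exact: (subspaceZ _ sF).
  have ux : B u x = 0 by rewrite /u !formE (formC f x) xx xf; ring.
  have uf : B u f = 0 by rewrite /u !formE ff xf; ring.
  have wu : B w u = 1 by rewrite /u !formE wu0 wx wf; ring.
  clearbody u.
  have [uu|uu] := eqVneq (B u u) 0; last by exists u.
  (* w and u are isotropic with B w u = 1, so w + u has norm 2. *)
  exists (w + u); split; [exact: (subspaceD sF)|by rewrite formDl wx ux addr0|
    by rewrite formDl wf uf addr0|].
  by rewrite formDl !formDr ww uu (formC u) wu add0r addr0.
apply: (submod_anisotropic h EF FE _ Fn nn big).
have := wedge_submod (wedge_so_block hFF hp h EF FE Ff Fn Fx Ff _ ff nx nf) Nx.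
rewrite (formC f) xf => /(_ erefl); rewrite (formC x n) nx scale0r sub0r scale1r.
by move=> /(subspaceN sN); rewrite opprK.
Qed.

Lemma submod_self_orth x E F : straddles FF x E F -> E = orth B F -> F `<=` orth B E ->
  N x -> E `<=` N.
Proof.
move=> h EF FE Nx y Ey; have [Fx nEx] : F x /\ ~ E x by case: h.
apply: (submod_isotropic_member (straddles_memE h) _ Ey _ (FE _ Fx _ Ey) Nx).
  by apply: (subset_trans (straddles_sub h)).
by rewrite EF orth_closed -EF.
Qed.

Lemma so_block_exceptional x E F y : straddles FF x E F -> E = orth B F ->
    F `<=` orth B E -> F y -> ~ add_line E x y ->
    F `<=` add_line (add_line E x) y ->
  exceptional x /\ orth_closure B F = F.
Proof.
move=> h EF FE Fy ny Fl; have [Fx nEx] : F x /\ ~ E x by case: h.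
have sE := member_subspace gFF (straddles_memE h).
have sF := member_subspace gFF (straddles_memF h).
have cE : orth_closure B E = E by rewrite EF orth_closed.
have sEx := add_line_subspace x sE; have sExy := add_line_subspace y sEx.
have FE' : F = add_line (add_line E x) y.
  apply/seteqP; split=> //; apply: (add_line_min sF) => //.
  exact: (add_line_min sF (straddles_sub h)).
have cF : orth_closure B F = F.
  by rewrite FE'; apply: (add_line_closed y sEx); exact: add_line_closed.
split=> //; exists E; split=> //; last exact: FE.
split=> //; first exact: (straddles_memE h).
- by split=> //; exact: (subset_trans (straddles_sub h)).
- rewrite EF -/(orth_closure B F) cF -EF.
  by apply: (quot_dim2_lines sE (straddles_sub h) Fx Fy).
Qed.

(** The position of x relative to F^perp and E^perp leaves three cases: F isotropic; E = F^perp,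
    with so acting on F / E; E^perp inside E. Closedness of F is recorded in the exceptional outcome
    so that dense pairs can exclude it. *)
Lemma submod_closed_pair x E F : straddles FF x E F -> orth_closure B E = E -> N x ->
  E `<=` N /\ F `<=` N \/ exceptional x /\ orth_closure B F = F.
Proof.
move=> h cE Nx; have [Fx nEx] : F x /\ ~ E x by case: h.
have sE := member_subspace gFF (straddles_memE h).
have sF := member_subspace gFF (straddles_memF h).
have [iFx|niFx] := pselect (orth B F x).
  have iF := orth_mem hFF h (straddles_memF h) iFx.
  have EN := submod_isotropic_pair h cE iF Nx.
  by left; split=> //; apply: (submod_above_pair h cE) => //; left.
have FE := orth_nmem hFF h (straddles_memF h) niFx.
have [Ex|nEox] := pselect (orth B E x).
  have FEo := orth_mem hFF h (straddles_memE h) Ex.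
  have EF : E = orth B F.
    apply/seteqP; split=> //; apply: subset_trans (orthS FEo).
    exact: sub_closure.
  have EN := submod_self_orth h EF FEo Nx.
  have [Fl|/existsNP[y /not_implyP[Fy ny]]] := pselect (F `<=` add_line E x).
    by left; split=> //; apply: (subset_trans Fl); exact: add_line_min.
  have [Fl|nFl] := pselect (F `<=` add_line (add_line E x) y).
    by right; exact: (so_block_exceptional h EF FEo Fy ny).
  left; split=> //; apply: (submod_so_block h EF FEo Nx) => q r Fq Fr Fl.
  by apply: nFl; exact: (add_line2_exchange sE nEx ny Fx Fy Fl).
have cEE := orth_nmem hFF h (straddles_memE h) nEox.
have [iE|niE] := pselect (E `<=` orth B E); last first.
  have EN : E `<=` N.
    by apply: (submod_coisotropic_member (straddles_memE h)) Nx; rewrite ?cE.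
  by left; split=> //; apply: (submod_above_pair h cE) => //; right.
have EE : E = orth B E by apply/seteqP.
have [Fl|/existsNP[z /not_implyP[Fz nz]]] := pselect (F `<=` add_line E x).
  by right; exact: (maximal_isotropic_exceptional h EE Fl).
have EN := submod_maximal_isotropic h EE Fz nz Nx.
by left; split=> //; apply: (submod_above_pair h cE) => //; right.
Qed.

(** D is closed and E is not, so E / D is infinite-dimensional: there is room for z orthogonal to v
    and x, where B x v = 1, and for the auxiliary w. Then (z /\ v) x = z. *)
Lemma submod_so_block_dense x D E y : straddles FF y D E -> D = orth B E ->
    E `<=` orth B D -> orth_closure B E <> E -> ~ orth B E x -> N x ->
  exists t, [/\ N t, E t & ~ D t].
Proof.
move=> h DE ED nE nEx Nx; have sE := member_subspace gFF (straddles_memF h).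
have sD := member_subspace gFF (straddles_memE h).
have cD : orth_closure B D = D by rewrite DE orth_closed.
have DsE := straddles_sub h.
have big q r u : E q -> E r -> E u ->
    ~ E `<=` add_line (add_line (add_line D u) q) r.
  move=> Eq Er Eu El; apply: nE.
  have -> : E = add_line (add_line (add_line D u) q) r.
    apply/seteqP; split=> //; apply: (add_line_min sE) => //.
    by apply: (add_line_min sE) => //; exact: (add_line_min sE).
  have s1 := add_line_subspace u sD; have s2 := add_line_subspace q s1.
  by apply: (add_line_closed r s2); apply: (add_line_closed q s1); exact: add_line_closed.
have [v Ev xv] := not_orth sE nEx.
have [q r Eq Er El|z [Ez nDz zv zx]] := @generic_orth E D v x sE.
  apply: (big q r q) => //; apply: (subset_trans El); apply: add_lineS.
  by apply: add_lineS; exact: sub_add_line.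
have [q r Eq Er|w [Ew nw wv wz]] := @generic_orth E (add_line D z) v z sE.
  exact: big.
rewrite DE in nw; have [a1 [Ea1 za wa]] := separate_line sE nw.
exists z; split=> //.
have pzv : p (wedge z v).
  apply: (wedge_so_block hFF hp h DE ED Ez Ev Ew Ea1); by rewrite formC.
have := wedge_submod pzv Nx; by rewrite xv (formC x) zx scale1r scale0r subr0.
Qed.

Lemma submod_dense_pair x E F : straddles FF x E F -> orth_closure B E <> E -> N x ->
  E `<=` N.
Proof.
move=> h nE Nx; have [Fx nEx] : F x /\ ~ E x by case: h.
have hE := straddles_memE h; have sE := member_subspace gFF hE.
have cE : orth_closure B E = F by case: (straddles_closure hFF h).
have oE : orth B E = orth B F.
  by have : orth B (orth_closure B E) = _ := orth_closed E; rewrite cE => ->.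
(* A predecessor of E is closed, for otherwise E would be its closure. *)
have predD y D : straddles FF y D E -> orth_closure B D = D.
  move=> hy; case: (straddles_closure hFF hy) => // DE.
  by case: nE; rewrite -DE; exact: orth_closed.
have [iFx|niFx] := pselect (orth B F x).
  have iF := orth_mem hFF h (straddles_memF h) iFx; have EF := straddles_sub h.
  have iE : E `<=` orth B E by rewrite oE; exact: (subset_trans EF).
  move=> y Ey; have [->|/eqP y0] := eqVneq y 0; first exact: subspace0.
  have [D [K hy]] := straddles_ex gFF y0; have Ky : K y by case: hy.
  have xy : B x y = 0 by apply: (iF _ Fx); exact: EF.
  have [KE|KE] := pselect (K = E); last first.
    have KsE := straddles_mem gFF hy hE Ey.
    apply: (submod_isotropic_member (straddles_memF hy) _ Ky _ xy Nx).
      by apply: (subset_trans KsE); apply: (subset_trans iE); exact: orthS.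
    by move=> /(closure_strict hFF h hy Ey KE).
  rewrite KE in hy.
  have [|v [_ _ xv pv]] := wedge_sl (t := x) hFF hp hy (predD _ _ hy) (or_introl iE) Ey.
    by move=> /(add_line_min sE (straddles_sub hy) Ey).
  by have := wedge_submod pv Nx; rewrite xv xy scale1r scale0r subr0.
have cEE : orth B E `<=` E by rewrite oE; exact: (orth_nmem hFF h (straddles_memF h)).
have niE : ~ E `<=` orth B E.
  move=> iE; apply: nE; have EE : E = orth B E by apply/seteqP.
  by rewrite /orth_closure -!EE.
(* With a predecessor D, it suffices to find a vector of N in E \ D: the closed case for (D, E)
   cannot be exceptional since E is not closed. *)
have [[y [D [Ey hy]]]|nop] := pselect (exists y D, E y /\ straddles FF y D E).
  have cD := predD _ _ hy; have nDy : ~ D y by case: hy.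
  suff [t [Nt Et nDt]] : exists t, [/\ N t, E t & ~ D t].
    by have [[_]|[_]] := submod_closed_pair (straddles_in hy Et nDt) cD Nt.
  have niEy : ~ orth B E y by move=> /(orth_mem hFF hy hE).
  have oED := orth_nmem hFF hy hE niEy.
  have [Dy|nDoy] := pselect (orth B D y).
    have ED := orth_mem hFF hy (straddles_memE hy) Dy.
    apply: (submod_so_block_dense hy _ ED nE _ Nx).
      by apply/seteqP; split=> //; rewrite -{1}cD; exact: orthS.
    by move=> /cEE.
  have cDD := orth_nmem hFF hy (straddles_memE hy) nDoy.
  have [|v [Dv _ xv pv]] := wedge_sl (t := x) hFF hp hy cD (or_intror cDD) Ey.
    by move=> /(add_line_min sE (straddles_sub hy) Ey).
  have DE := straddles_sub hy; have sD := member_subspace gFF (straddles_memE hy).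
  exists (y - B x y *: v); split.
  - by have := wedge_submod pv Nx; rewrite xv scale1r.
  - by apply: (subspaceB sE) => //; apply: (subspaceZ _ sE); apply: DE; exact: cDD.
  - move=> /(subspaceBK sD) h'; apply: nDy; apply: h'.
    by apply: (subspaceZ _ sD); exact: cDD.
(* Without a predecessor, E is a union of members whose closures stay in E and so miss x. One of
   them contains y and a nonorthogonal pair e, e'; it is coisotropic and not isotropic. *)
have mem y : E y -> y <> 0 -> exists K, [/\ FF K, K y, K `<=` E & ~ orth_closure B K x].
  move=> Ey y0; have [D [K hy]] := straddles_ex gFF y0.
  have KE : K <> E by move=> KE; apply: nop; exists y, D; rewrite -{2}KE.
  exists K; split; [exact: (straddles_memF hy)|by case: hy| |].
    exact: (straddles_mem gFF hy hE Ey).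
  by move=> /(closure_strict hFF h hy Ey KE).
have max K1 K2 : FF K1 -> FF K2 -> exists K, [/\ K = K1 \/ K = K2, K1 `<=` K & K2 `<=` K].
  move=> h1 h2; have [?|?] := member_total gFF h1 h2.
    by exists K2; split=> //; right.
  by exists K1; split=> //; left.
have [e [e' [Ee Ee' ee]]] : exists e e', [/\ E e, E e' & B e e' <> 0].
  apply: contrapT => hn; apply: niE => e Ee e' Ee'; apply: contrapT => ee.
  by apply: hn; exists e, e'.
move=> y Ey; have [->|/eqP y0] := eqVneq y 0; first exact: subspace0.
have [|K0 [hK0 Ky K0E K0x]] := mem y Ey; first by [].
have [|K1 [hK1 Ke K1E K1x]] := mem e Ee; first by move=> e0; apply: ee; rewrite e0 form0l.
have [|K2 [hK2 Ke' K2E K2x]] := mem e' Ee'; first by move=> e0; apply: ee; rewrite e0 form0r.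
have [K3 [h3 K03 K13]] := max _ _ hK0 hK1.
have [hK3 K3E K3x] : [/\ FF K3, K3 `<=` E & ~ orth_closure B K3 x] by case: h3 => ->.
have [K [h4 K34 K24]] := max _ _ hK3 hK2.
have [hK KE Kx] : [/\ FF K, K `<=` E & ~ orth_closure B K x] by case: h4 => ->.
have Ke2 := K24 _ Ke'; have Ke1 := K34 _ (K13 _ Ke).
have nKe : ~ orth B K e by move=> /(_ _ Ke2).
apply: (submod_coisotropic_member hK _ _ Kx Nx); last by apply: K34; exact: K03.
  have e0 : e <> 0 by move=> e0; apply: ee; rewrite e0 form0l.
  have [D [D' he]] := straddles_ex gFF e0.
  apply: (subset_trans (orth_nmem hFF he hK nKe)).
  exact: (subset_trans (straddles_sub he) (straddles_mem gFF he hK Ke1)).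
by move=> /(_ _ Ke1).
Qed.

End Submodule.

(** * Hyperbolic planes *)

Definition hyperbolic_frame L e f :=
  [/\ orth B L e, orth B L f, B e e = 0 /\ B f f = 0, B e f = 1 &
      forall x, orth B L x -> L (x - (B x f *: e + B x e *: f))].

Lemma hyperbolic_frameC L e f : hyperbolic_frame L e f -> hyperbolic_frame L f e.
Proof.
case=> Le Lf [ee ff] ef h; split=> // [|x /h]; first by rewrite formC.
by rewrite [_ *: e + _]addrC.
Qed.

Section FrameTheory.
Variables (L : set V) (e f : V).
Hypotheses (iL : isotropic B L) (cL : orth_closure B L = L).
Hypothesis (hef : hyperbolic_frame L e f).
Let sL : subspace L. Proof. by case: iL. Qed.
Let LL : L `<=` orth B L. Proof. by case: iL. Qed.
Let Le : orth B L e. Proof. by case: hef. Qed.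
Let Lf : orth B L f. Proof. by case: hef. Qed.
Let ee : B e e = 0. Proof. by case: hef => _ _ []. Qed.
Let ef : B e f = 1. Proof. by case: hef. Qed.
Let sM : subspace (add_line L e). Proof. exact: add_line_subspace. Qed.

Lemma frame_nmem : ~ L e.
Proof. by move=> /Lf /eqP; rewrite formC ef oner_eq0. Qed.

Lemma frame_line_sub : add_line L e `<=` orth B L.
Proof. exact: (add_line_min (orth_subspace L)). Qed.

Lemma frame_line_orth : orth B (add_line L e) = add_line L e.
Proof.
apply/seteqP; split=> [x hx|x [c Lx] y [d Ly]].
  have Lx : orth B L x by apply: (orthS _ hx); exact: sub_add_line.
  case: hef => _ _ _ _ /(_ x Lx).
  rewrite (hx e) ?scale0r ?addr0 => [h|]; first by exists (B x f).
  exact: add_line_self.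
rewrite -[x](subrK (c *: e)) -[y](subrK (d *: e)).
move: (x - c *: e) (y - d *: e) Lx Ly => l m Ll Lm.
by rewrite !formE (LL Ll Lm) ee (formC l) (Le Ll) (Le Lm); ring.
Qed.

Lemma frame_line_nmem : ~ add_line L e f.
Proof.
rewrite -frame_line_orth => /(_ e (add_line_self e sL)) /eqP.
by rewrite formC ef oner_eq0.
Qed.

Lemma frame_line_maximal : maximal_isotropic B (add_line L e).
Proof.
split; first by split=> //; rewrite frame_line_orth.
move=> M [sM' iM] LM; apply/seteqP; split=> //.
by rewrite -[X in _ `<=` X]frame_line_orth; apply: (subset_trans iM); exact: orthS.
Qed.

(** The isotropic lines are the weight lines of so(2): skewness gives B (X e) e = 0, so X e lies in
    (L + C e)^perp = L + C e. *)
Lemma frame_line_stable X : skew X -> stable X L -> stable X (add_line L e).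
Proof.
move=> kX XL; have XO := stable_orth kX XL.
have Xe : add_line L e (X e).
  rewrite -frame_line_orth => y [c Ly]; rewrite -[y](subrK (c *: e)) formDr formZr.
  rewrite (XO _ Le _ Ly) add0r.
  suff -> : B (X e) e = 0 by rewrite mulr0.
  have := kX e e; rewrite (formC e) => /eqP; rewrite -addr_eq0 -mulr2n mulrn_eq0 /=.
  by move/eqP.
move=> y [c Ly]; rewrite -[y](subrK (c *: e)).
move: (y - _) Ly => l Ll; rewrite (skewD _ _ kX) (skewZ _ _ kX).
apply: (subspaceD sM); first by apply: sub_add_line; exact: XL.
exact: (subspaceZ _ sM).
Qed.

Lemma frame_span : orth B L `<=` add_line (add_line L e) f.
Proof.
move=> x Lx; case: hef => _ _ _ _ /(_ x Lx) h.
by exists (B x e), (B x f); rewrite -addrA -opprD [_ *: f + _]addrC.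
Qed.

(** Modulo L a vector is a e + b f, of norm 2 a b; if it is isotropic, a or b vanishes. *)
Lemma frame_isotropic G : subspace G -> L `<=` G -> G `<=` orth B L ->
  G `<=` orth B G -> ~ G `<=` L -> add_line L e `<=` G \/ add_line L f `<=` G.
Proof.
move=> sG LG GL iG /existsNP[x /not_implyP[Gx nLx]].
case: hef => _ _ _ _ /(_ _ (GL _ Gx)); set y := (_ - _) => Ly.
have : B x x = 0 by exact: iG.
have -> : B x x = B x y + (B x f * B x e) *+ 2 by rewrite /y !formE; ring.
rewrite (GL _ Gx _ Ly) add0r => /eqP; rewrite mulrn_eq0 /= mulf_eq0.
move: Ly; rewrite /y; move=> Ly /orP[/eqP h|/eqP h]; move: Ly; rewrite h scale0r.
  rewrite add0r => Ly; right; apply: (add_line_min sG LG).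
  apply: (subspaceZK (a := B x e) sG).
    by apply/eqP => h2; apply: nLx; move: Ly; rewrite h2 scale0r subr0.
  by have := subspaceB sG Gx (LG _ Ly); rewrite opprB addrC subrK.
rewrite addr0 => Ly; left; apply: (add_line_min sG LG).
apply: (subspaceZK (a := B x f) sG).
  by apply/eqP => h2; apply: nLx; move: Ly; rewrite h2 scale0r subr0.
by have := subspaceB sG Gx (LG _ Ly); rewrite opprB addrC subrK.
Qed.

End FrameTheory.

Lemma two_maximal_isotropics_frame L e f : isotropic B L ->
  hyperbolic_frame L e f -> two_maximal_isotropics B L (add_line L e) (add_line L f).
Proof.
move=> iL hef; have hfe := hyperbolic_frameC hef; have [sL _] := iL.
split=> [h|M].
  by apply: (frame_line_nmem iL hef); rewrite h; exact: add_line_self.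
split=> [[[[sM iM] hM] LM]|].
  have := frame_isotropic hef sM LM (subset_trans iM (orthS LM)) iM.
  have [ML|nML] := pselect (M `<=` L).
    have [iM1 _] := frame_line_maximal iL hef.
    have ME := hM _ iM1 (subset_trans ML (@sub_add_line _ _ L e)).
    by case: (frame_nmem hef); apply: (ML); rewrite -ME; exact: add_line_self.
  move=> /(_ nML)[h|h]; [left|right].
    by case: (frame_line_maximal iL hef) => _; apply.
  by case: (frame_line_maximal iL hfe) => _; apply.
by case=> ->; split; [exact: frame_line_maximal hef|exact: sub_add_line|
  exact: frame_line_maximal hfe|exact: sub_add_line].
Qed.

Lemma isotropic_combination x y : exists a c,
  (a != 0) || (c != 0) /\ B (a *: x + c *: y) (a *: x + c *: y) = 0.
Proof.
have [xx|xx] := eqVneq (B x x) 0.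
  by exists 1, 0; rewrite oner_eq0 !formE xx; split=> //; ring.
(* A square root of the reduced discriminant; the witness is a root t of B x x t^2 + 2 B x y t + B y
   y. *)
pose q := sqrtC (B x y ^+ 2 - B x x * B y y).
have qq : q ^+ 2 = B x y ^+ 2 - B x x * B y y by exact: sqrtCK.
exists ((q - B x y) / B x x), 1; rewrite oner_eq0 orbT; split=> //.
rewrite !formE (formC y x).
have -> : B y y = (B x y ^+ 2 - q ^+ 2) / B x x by rewrite qq; field.
by field.
Qed.

Lemma hyperbolic_frame_ex L : isotropic B L -> orth_closure B L = L ->
  quot_dim (orth B L) L 2 -> exists e f, hyperbolic_frame L e f.
Proof.
move=> [sL iL] cL /quot_dim2P[LO [x [y [Lx Ly free span]]]].
have sO := orth_subspace L; have half : (2 : R[i]) != 0 by rewrite pnatr_eq0.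
have [a [c [ac ee]]] := isotropic_combination x y; set e := _ + _ in ee.
have Le : orth B L e by apply: (subspaceD sO); exact: (subspaceZ _ sO).
have nLe : ~ L e.
  by move=> /free[a0 c0]; move: ac; rewrite a0 c0 eqxx.
have [g Lg eg] := separate_closed cL nLe.
pose f := g - (B g g / 2) *: e.
have Lf : orth B L f by apply: (subspaceB sO) => //; exact: (subspaceZ _ sO).
clearbody e.
have ef : B e f = 1 by rewrite /f !formE ee eg; ring.
have ff : B f f = 0 by rewrite /f !formE ee (formC g e) eg; field.
clearbody f.
exists e, f; split=> // z Lz.
have nf : ~ add_line L e f.
  move=> [d /Le]; rewrite !formE ee ef mulr0 subr0 => /eqP.
  by rewrite oner_eq0.
have hspan : orth B L `<=` add_line (add_line L x) y.
  by move=> t /span[u [v h]]; exists v, u; rewrite -addrA -opprD [_ *: y + _]addrC.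
have [d [b]] := add_line2_exchange sL nLe nf Le Lf hspan Lz.
set l := (_ - _) => Ll.
have zE : z = l + b *: e + d *: f by rewrite /l !subrK.
clearbody l.
have zf : B z f = b by rewrite zE !formE ef ff (formC l) (Lf _ Ll); ring.
have ze : B z e = d by rewrite zE !formE ee (formC f) ef (formC l) (Le _ Ll); ring.
by rewrite zf ze {1}zE -(addrA l) addrK.
Qed.

(** * The upper member at a nonexceptional vector is determined by p *)

Section Uniqueness.
Variable p : set (V -> V).

Lemma stable_member FF G : between FF p -> FF G -> forall X, p X -> stable X G.
Proof. by case=> _ ps _ _ hG X /ps[_ h]; exact: h. Qed.

Lemma submod_nonexceptional FF N x E F : self_taut B FF -> between FF p ->
    straddles FF x E F -> ~ exceptional FF x ->
    subspace N -> (forall X, p X -> stable X N) -> N x ->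
  E `<=` N /\ (orth_closure B E = E -> F `<=` N).
Proof.
move=> hFF hp h nx sN pN Nx.
have [cE|nE] := pselect (orth_closure B E = E).
  by have [[]|[]//] := submod_closed_pair hFF hp sN pN h cE Nx.
by split=> //; exact: (submod_dense_pair hFF hp sN pN h nE Nx).
Qed.

Lemma submod_exceptional FF L N x : self_taut B FF -> between FF p ->
    hyperbolic_plane_member B FF L -> orth B L x -> ~ L x ->
    (forall X, p X -> stable X N) -> N x ->
  L `<=` N.
Proof.
move=> hFF hp [hL [_ iL] cL _] Lx nLx pN Nx y Ly.
by apply: (submod_isotropic_member hFF hp pN hL iL Ly _ _ Nx); [rewrite cL|exact: Lx].
Qed.

(** X takes at x the same value as at some vector of E, so X x is already in E. *)
Lemma dense_line_stable FF x E F : self_taut B FF -> between FF p ->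
    straddles FF x E F -> orth_closure B E <> E ->
  forall X, p X -> stable X (add_line E x).
Proof.
move=> hFF [_ ps _ _] h nE X /ps[soX sX] y [c Ey].
have [gFF _ _] := hFF; have sE := member_subspace gFF (straddles_memE h).
have kX := so_skew soX; have [_ Fx _] := h.
have [|z Ez Xxz] := so_closure (x := x) soX sE.
  by case: (straddles_closure hFF h) => [//|->].
apply: sub_add_line; rewrite -[y](subrK (c *: x)); move: (y - _) Ey => l El.
rewrite (skewD _ _ kX) (skewZ _ _ kX) Xxz.
have XE := sX _ (straddles_memE h).
by apply: (subspaceD sE); [|apply: (subspaceZ _ sE)]; exact: XE.
Qed.

Lemma exceptional_pair FF x y E F : self_taut B FF -> straddles FF x E F ->
  straddles FF y E F -> exceptional FF x -> exceptional FF y.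
Proof.
move=> hFF hx hy [L [hL Lx nLx]]; exists L; split=> //; have [gFF _ _] := hFF.
  have [mL _ _ _] := hL.
  by apply: (orth_mem hFF hx mL Lx); case: hy.
have [mL _ _ _] := hL => Ly; apply: nLx.
by apply: (straddles_mem gFF hy mL Ly); case: hx.
Qed.

(** E' + C x is [p]-stable, so FF forces F into it, while GG forces E' into F. Then E' lies in E,
    and E, which misses x, lies in E'; but only one of them is closed. *)
Lemma closed_dense_false FF GG x E F E' F' :
    self_taut B FF -> self_taut B GG -> between FF p -> between GG p ->
    straddles FF x E F -> straddles GG x E' F' ->
    ~ exceptional FF x -> ~ exceptional GG x ->
    orth_closure B E = E -> orth_closure B E' <> E' -> False.
Proof.
move=> hFF hGG pF pG h h' nF nG cE nE'.
have [gFF _ _] := hFF; have [gGG _ _] := hGG.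
have sE := member_subspace gFF (straddles_memE h).
have sE' := member_subspace gGG (straddles_memE h').
have [Fx nEx] : F x /\ ~ E x by case: h.
have [_ nE'x] : F' x /\ ~ E' x by case: h'.
have [_ /(_ cE) FE'] := submod_nonexceptional hFF pF h nF (add_line_subspace x sE')
  (dense_line_stable hGG pG h' nE') (add_line_self x sE').
have [E'F _] := submod_nonexceptional hGG pG h' nG (member_subspace gFF (straddles_memF h))
  (stable_member pF (straddles_memF h)) Fx.
have E'E : E' `<=` E.
  move=> y E'y; apply: contrapT => nEy.
  have hy := straddles_in h (E'F _ E'y) nEy.
  have ny : ~ exceptional FF y by move=> /(exceptional_pair hFF hy h).
  apply: nE'x; apply: (submod_nonexceptional hFF pF hy ny sE' _ E'y).2 => //.
  exact: (stable_member pG (straddles_memE h')).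
apply: nE'; rewrite (_ : E' = E) //; apply/seteqP; split=> // y Ey.
have [c] := FE' _ (straddles_sub h Ey).
have [->|c0] := eqVneq c 0; first by rewrite scale0r subr0.
move=> /E'E/(subspaceB sE Ey); rewrite opprB addrC subrK => /(subspaceZK sE c0).
by [].
Qed.

Lemma nonexceptional_sub FF GG x E F E' F' :
    self_taut B FF -> self_taut B GG -> between FF p -> between GG p ->
    straddles FF x E F -> straddles GG x E' F' ->
    ~ exceptional FF x -> ~ exceptional GG x -> F `<=` F'.
Proof.
move=> hFF hGG pF pG h h' nF nG; have [gGG _ _] := hGG.
have [_ F'x _] := h'.
have [EF' FF'] := submod_nonexceptional hFF pF h nF
  (member_subspace gGG (straddles_memF h')) (stable_member pG (straddles_memF h')) F'x.
have [/FF' //|nE] := pselect (orth_closure B E = E).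
have [cE'|nE'] := pselect (orth_closure B E' = E').
  by case: (closed_dense_false hGG hFF pG pF h' h nG nF cE' nE).
have cE : orth_closure B E = F by case: (straddles_closure hFF h).
have cE' : orth_closure B E' = F' by case: (straddles_closure hGG h').
rewrite -cE; apply: (subset_trans (closureS EF')).
by rewrite -cE' orth_closed.
Qed.

Lemma nonexceptional_eq FF GG x E F E' F' :
    self_taut B FF -> self_taut B GG -> between FF p -> between GG p ->
    straddles FF x E F -> straddles GG x E' F' ->
    ~ exceptional FF x -> ~ exceptional GG x -> F = F'.
Proof.
move=> hFF hGG pF pG h h' nF nG; apply/seteqP; split.
  exact: (nonexceptional_sub hFF hGG pF pG h h').
exact: (nonexceptional_sub hGG hFF pG pF h' h).
Qed.

End Uniqueness.

(** Lower members are recovered from upper ones: a nonzero vector of F lies outside E exactly when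
    its own upper member is F. *)
Lemma flag_ext_sub FF GG : generalized_flag FF -> generalized_flag GG ->
    (forall x E F E' F', straddles FF x E F -> straddles GG x E' F' -> F = F') ->
  FF `<=` GG.
Proof.
move=> gFF gGG hx G hG.
have nz (D : set V) y : FF D \/ GG D -> ~ D y -> y <> 0.
  by move=> hD nDy y0; apply: nDy; rewrite y0;
    case: hD => [/(member_subspace gFF)|/(member_subspace gGG)][].
have [E [F [hEF GEF]]] : exists E F, immediate_pair FF E F /\ (G = E \/ G = F).
  case: gFF => _ _ /(_ G hG)[G' [h|h]] _; first by exists G', G; split; auto.
  by exists G, G'; split; auto.
have [x h] := pair_straddles hEF.
have [E' [F' h']] := straddles_ex gGG (straddles_nz gFF h).
have FF' := hx _ _ _ _ _ h h'.
case: GEF => ->; last by rewrite FF'; exact: (straddles_memF h').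
suff -> : E = E' by exact: (straddles_memE h').
have [[_ Fx nEx] [_ _ nE'x]] := (h, h').
apply/seteqP; split=> y yE; apply: contrapT => ny.
  have hy' : straddles GG y E' F'.
    by apply: (straddles_in h') => //; rewrite -FF'; exact: (straddles_sub h).
  have [E1 [F1 hy]] := straddles_ex gFF (straddles_nz gGG hy').
  apply: nEx; apply: (straddles_mem gFF hy (straddles_memE h) yE).
  by rewrite (hx _ _ _ _ _ hy hy') -FF'.
have hy : straddles FF y E F.
  by apply: (straddles_in h) => //; rewrite FF'; exact: (straddles_sub h').
have [E1 [F1 hy']] := straddles_ex gGG (straddles_nz gFF hy).
apply: nE'x; apply: (straddles_mem gGG hy' (straddles_memE h') yE).
by rewrite -(hx _ _ _ _ _ hy hy').
Qed.

Lemma flag_ext FF GG : generalized_flag FF -> generalized_flag GG ->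
    (forall x E F E' F', straddles FF x E F -> straddles GG x E' F' -> F = F') ->
  FF = GG.
Proof.
move=> gFF gGG hx; apply/seteqP; split; first exact: flag_ext_sub.
apply: flag_ext_sub => // x E F E' F' h h'; apply/esym.
exact: (hx _ _ _ _ _ h' h).
Qed.

(** * Members between L and its orthogonal complement *)

Section HyperbolicMember.
Variables (FF : set (set V)) (L : set V) (e f : V).
Hypotheses (hFF : self_taut B FF) (hL : hyperbolic_plane_member B FF L).
Hypothesis hef : hyperbolic_frame L e f.
Let gFF : generalized_flag FF. Proof. by case: hFF. Qed.
Let FL : FF L. Proof. by case: hL. Qed.
Let iL : isotropic B L. Proof. by case: hL. Qed.
Let sL : subspace L. Proof. by case: iL. Qed.
Let cL : orth_closure B L = L. Proof. by case: hL. Qed.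
Let hfe : hyperbolic_frame L f e. Proof. exact: hyperbolic_frameC. Qed.
Let M := add_line L e.

(** By self-tautness G lies in G^perp or contains it, so one of the two is an isotropic subspace
    between L and L^perp. If it contains L + C e or L + C f, G equals that. If G^perp is inside L,
    then cl G contains L^perp, and G is closed, being finite-dimensional over L. *)
Lemma member_between G : FF G ->
  [\/ G `<=` L, orth B L `<=` G, G = M | G = add_line L f].
Proof.
move=> hG; have sG := member_subspace gFF hG.
have [GL|nGL] := pselect (G `<=` L); first by constructor 1.
have [OG|nOG] := pselect (orth B L `<=` G); first by constructor 2.
have [//|LG] := member_total gFF hG FL.
have GO : G `<=` orth B L.
  move=> g Gg; apply: contrapT => nOg.
  have g0 : g <> 0 by move=> g0; apply: nOg; rewrite g0; case: (orth_subspace L).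
  have [D [K hg]] := straddles_ex gFF g0.
  apply: nOG; apply: (subset_trans (orth_nmem hFF hg FL nOg)).
  exact: (subset_trans (straddles_sub hg) (straddles_mem gFF hg hG Gg)).
have max e' f' : hyperbolic_frame L e' f' -> add_line L e' `<=` G ->
    add_line L e' `<=` orth B G -> G = add_line L e'.
  move=> h' MG MoG; apply/seteqP; split=> //.
  rewrite -(frame_line_orth iL h'); apply: subset_trans (orthS MoG).
  exact: sub_closure.
have [iG|/existsNP[g /not_implyP[Gg nGg]]] := pselect (G `<=` orth B G).
  have [MG|MG] := frame_isotropic hef sG LG GO iG nGL.
    by constructor 3; apply: (max _ _ hef MG); exact: (subset_trans MG).
  by constructor 4; apply: (max _ _ hfe MG); exact: (subset_trans MG).
have g0 : g <> 0 by move=> g0; apply: nGg; rewrite g0; case: (orth_subspace G).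
have [D [K hg]] := straddles_ex gFF g0.
have oGG : orth B G `<=` G.
  apply: (subset_trans (orth_nmem hFF hg hG nGg)).
  exact: (subset_trans (straddles_sub hg) (straddles_mem gFF hg hG Gg)).
have [oGL|noGL] := pselect (orth B G `<=` L).
  case: nOG; move/existsNP: nGL => [x /not_implyP[Gx nLx]].
  have cG : orth B L `<=` orth_closure B G by exact: orthS.
  have LxG := add_line_min sG LG Gx.
  have [GLx|/existsNP[y /not_implyP[Gy ny]]] := pselect (G `<=` add_line L x).
    have -> : G = add_line L x by apply/seteqP.
    by rewrite -(add_line_closed x sL cL); apply: (subset_trans cG); exact: closureS.
  apply: (subset_trans (add_line2_exchange sL nLx ny (GO _ Gx) (GO _ Gy) (frame_span hef))).
  exact: (add_line_min sG).
have LoG : L `<=` orth B G by rewrite -cL; exact: orthS.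
have [MG|MG] := frame_isotropic hef (orth_subspace G) LoG (subset_trans oGG GO)
  (orthS oGG) noGL.
  by constructor 3; apply: (max _ _ hef) => //; exact: (subset_trans MG).
by constructor 4; apply: (max _ _ hfe) => //; exact: (subset_trans MG).
Qed.

Lemma line_stable X : stabilizer (so_infty B) FF X -> stable X M.
Proof.
move=> [soX sX]; apply: (frame_line_stable iL hef) (sX _ FL); exact: so_skew.
Qed.

End HyperbolicMember.

(** Otherwise the upper members at e and f would be the incomparable L + C e and L + C f. *)
Lemma hyperbolic_orth_mem FF L : self_taut B FF -> hyperbolic_plane_member B FF L ->
  FF (orth B L).
Proof.
move=> hFF hL; have [gFF _ _] := hFF; have [FL iL cL q2] := hL.
have [e [f hef]] := hyperbolic_frame_ex iL cL q2.
have hfe := hyperbolic_frameC hef.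
have key e1 f1 : hyperbolic_frame L e1 f1 -> FF (orth B L) \/ FF (add_line L e1).
  move=> h1; have [O1 _ _ _ _] := h1; have nL1 := frame_nmem h1.
  have e0 : e1 <> 0 by move=> e0; apply: nL1; rewrite e0; case: (iL) => -[].
  have [D [K h]] := straddles_ex gFF e0; have hK := straddles_memF h.
  have K1 : K e1 by case: h.
  have [/(_ _ K1)//|OK|KE|KE] := member_between hFF hL h1 hK.
  - left; rewrite (_ : orth B L = K) //; apply/seteqP; split=> //.
    exact: (orth_mem hFF h FL O1).
  - by right; rewrite -KE.
  - by case: (frame_line_nmem iL (hyperbolic_frameC h1)); rewrite -KE.
have [//|M1] := key _ _ hef; have [//|M2] := key _ _ hfe; have [sL _] := iL.
have [/(_ e (add_line_self e sL))|/(_ f (add_line_self f sL))] := member_total gFF M1 M2.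
  by move/(frame_line_nmem iL hfe).
by move/(frame_line_nmem iL hef).
Qed.

(** An isotropic member properly above K1 contains a maximal isotropic subspace over K1, hence its
    own orthogonal complement, and the quotient collapses. *)
Lemma hyperbolic_uniq FF L1 L2 : self_taut B FF -> hyperbolic_plane_member B FF L1 ->
  hyperbolic_plane_member B FF L2 -> L1 = L2.
Proof.
move=> hFF; have [gFF _ _] := hFF.
have key K1 K2 : hyperbolic_plane_member B FF K1 ->
    hyperbolic_plane_member B FF K2 -> K1 `<=` K2 -> K1 = K2.
  move=> [F1 i1 c1 q1] [F2 i2 c2 q2] K12; apply/seteqP; split=> //.
  have [e1 [f1 h1]] := hyperbolic_frame_ex i1 c1 q1.
  have [e2 [f2 h2]] := hyperbolic_frame_ex i2 c2 q2.
  have [O2 _ _ _ _] := h2.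
  have max e f : hyperbolic_frame K1 e f -> ~ add_line K1 e `<=` K2.
    move=> h le; apply: (frame_nmem h2); apply: (le).
    by rewrite -(frame_line_orth i1 h); exact: (orthS le).
  apply: contrapT => n21; have [s2 i2'] := i2.
  have [] := frame_isotropic h1 s2 K12 (subset_trans i2' (orthS K12)) i2' n21.
    exact: max h1.
  exact: max (hyperbolic_frameC h1).
move=> h1 h2; have [[F1 _ _ _] [F2 _ _ _]] := (h1, h2).
have [/(key _ _ h1 h2) //|/(key _ _ h2 h1) //] := member_total gFF F1 F2.
Qed.

Lemma gl_infty0 X : gl_infty B X -> X 0 = 0.
Proof.
apply: (@lspan_sub _ (V -> V : lmodType R[i]) _ [set X | X 0 = 0]).
  by split=> // a Y Z Y0 Z0; rewrite /= !fctE Y0 Z0 scaler0 addr0.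
by move=> _ [u [v ->]]; rewrite /= form0l scale0r.
Qed.

(** * Removing and inserting a maximal isotropic member *)

Section Truncation.
Variables (FF : set (set V)) (L : set V).
Hypotheses (hFF : self_taut B FF) (hL : hyperbolic_plane_member B FF L).
Let gFF : generalized_flag FF. Proof. by case: hFF. Qed.
Let FL : FF L. Proof. by case: hL. Qed.
Let FO : FF (orth B L). Proof. exact: hyperbolic_orth_mem. Qed.
Let LO : L `<=` orth B L. Proof. by case: hL => _ []. Qed.
Let cL : orth_closure B L = L. Proof. by case: hL. Qed.
Let T := truncated_flag B FF L.

Lemma truncated_straddles_out x E F : straddles FF x E F ->
  ~ (orth B L x /\ ~ L x) -> straddles T x E F.
Proof.
move=> h hx; have [[hE hF EF imm] Fx nEx] := h.
have side : F `<=` L \/ orth B L `<=` E.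
  have [Lx|nLx] := pselect (L x); first by left; exact: (straddles_mem gFF h).
  by right; apply: (straddles_nmem gFF h FO) => Ox; exact: hx.
have EsF := straddles_sub h; split=> //; split=> //; last by move=> G [/imm].
  by split=> //; case: side => s; [left; exact: subset_trans s|right].
by split=> //; case: side => s; [left|right; exact: subset_trans EsF].
Qed.

Lemma truncated_straddles_in x : orth B L x -> ~ L x -> straddles T x L (orth B L).
Proof.
move=> Ox nLx; split=> //; split.
- by split=> //; left.
- by split=> //; right.
- by split=> // /(_ _ Ox).
- by move=> G [_ [GL|OG]] LG GO; [left|right]; apply/seteqP.
Qed.

Lemma truncated_generalized_flag : generalized_flag T.
Proof.
split=> [F [/(member_subspace gFF)]|E F [hE _] [hF _]|F [hF side]|x x0] //.
- exact: (member_total gFF hE hF).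
- have [G hG] : exists G, immediate_pair FF G F \/ immediate_pair FF F G.
    by case: gFF => _ _ /(_ F hF).
  have [x hx] : exists x, straddles FF x G F \/ straddles FF x F G.
    by case: hG => /pair_straddles[x hx]; exists x; auto.
  have [[Ox nLx]|out] := pselect (orth B L x /\ ~ L x); last first.
    exists G; case: hx => /truncated_straddles_out/(_ out)[]; auto.
  have [imm _ _] := truncated_straddles_in Ox nLx.
  case: hx => h; have [_ Fx nGx] := h.
    exists L; left; suff -> : F = orth B L by [].
    apply/seteqP; split; first exact: (orth_mem hFF h FL).
    by case: side => // /(_ _ Fx).
  exists (orth B L); right; suff -> : F = L by [].
  apply/seteqP; split; first by case: side => // /(_ _ Ox).
  exact: (straddles_nmem gFF h FL).
- have [[Ox nLx]|out] := pselect (orth B L x /\ ~ L x).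
    by exists L, (orth B L); exact: truncated_straddles_in.
  have [E [F h]] := straddles_ex gFF x0.
  by exists E, F; exact: truncated_straddles_out.
Qed.

(** Removing a member can enlarge the gl-stabilizer, so self-tautness is not simply inherited. But
    F^perp contains the upper member, in the truncated flag, at each of its nonzero vectors, and
    that member is stable. *)
Lemma truncated_self_taut : self_taut B T.
Proof.
have gT := truncated_generalized_flag; split=> // [E F /pair_straddles[x hx]|].
  have [[Ox nLx]|out] := pselect (orth B L x /\ ~ L x).
    by have [-> ->] := straddles_uniq gT hx (truncated_straddles_in Ox nLx); left.
  have [E' [F' h]] := straddles_ex gFF (straddles_nz gT hx).
  have [-> ->] := straddles_uniq gT hx (truncated_straddles_out h out).
  exact: (straddles_closure hFF h).
move=> F [hF side] X [glX sX] y Fy.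
have [->|/eqP y0] := eqVneq y 0; first by rewrite gl_infty0 //; case: (orth_subspace F).
have [[Oy nLy]|out] := pselect (orth B L y /\ ~ L y).
  case: side => [FsL|OF]; last by case: nLy; rewrite -cL; exact: (orthS OF).
  apply: (orthS FsL); apply: (sX) Oy; split=> //; by right.
have [D [K h]] := straddles_ex gFF y0.
apply: (orth_mem hFF h hF Fy); have h' := truncated_straddles_out h out.
by apply: (sX _ (straddles_memF h')); case: h.
Qed.

End Truncation.

Section Insertion.
Variables (T : set (set V)) (L : set V) (e f : V).
Hypotheses (hT : self_taut B T) (iL : isotropic B L) (cL : orth_closure B L = L).
Hypotheses (hef : hyperbolic_frame L e f) (imm : immediate_pair T L (orth B L)).
Let gT : generalized_flag T. Proof. by case: hT. Qed.
Let hfe : hyperbolic_frame L f e. Proof. exact: hyperbolic_frameC. Qed.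
Let M := add_line L e.
Let T' := T `|` [set M].
Let Oe : orth B L e. Proof. by case: hef. Qed.
Let Of : orth B L f. Proof. by case: hfe. Qed.
Let sL : subspace L. Proof. by case: iL. Qed.
Let sM : subspace M. Proof. exact: add_line_subspace. Qed.
Let nLe : ~ L e. Proof. exact: (frame_nmem hef). Qed.
Let nMf : ~ M f. Proof. exact: (frame_line_nmem iL hef). Qed.
Let Me : M e. Proof. exact: add_line_self. Qed.
Let LM : L `<=` M. Proof. exact: sub_add_line. Qed.
Let MO : M `<=` orth B L. Proof. exact: (frame_line_sub iL hef). Qed.
Let oM : orth B M = M. Proof. exact: (frame_line_orth iL hef). Qed.
Let he : straddles T e L (orth B L). Proof. by []. Qed.
Let TL : T L. Proof. by case: imm. Qed.
Let TO : T (orth B L). Proof. by case: imm. Qed.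

Let side G : T G -> G `<=` L \/ orth B L `<=` G.
Proof.
move=> hG; have [Ge|nGe] := pselect (G e); first by right; exact: (straddles_mem gT he).
by left; exact: (straddles_nmem gT he).
Qed.

Let straddles_out x E F : straddles T x E F -> ~ (orth B L x /\ ~ L x) ->
  straddles T' x E F.
Proof.
move=> h out; have [[hE hF EF immEF] Fx nEx] := h; split=> //; split=> //; try by left.
move=> G [/immEF //|->] EM MF.
have [Lx|nLx] := pselect (L x).
  by case: nLe; apply: (straddles_mem gT h TL Lx); exact: MF.
case: nMf; apply: EM; apply: (straddles_nmem gT h TO) => // Ox; exact: out.
Qed.

Let straddles_lower x : M x -> ~ L x -> straddles T' x L M.
Proof.
move=> Mx nLx; split=> //; split; [by left|by right|by split=> // /(_ _ Mx)|].
move=> G [/side[GL|OG] LG GM|-> //]; last by right.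
  by left; apply/seteqP.
by case: nMf; apply: GM; exact: OG.
Qed.

Let straddles_upper x : orth B L x -> ~ M x -> straddles T' x M (orth B L).
Proof.
move=> Ox nMx; split=> //; split; [by right|by left|by split=> // /(_ _ Ox)|].
move=> G [/side[GL|OG] MG GO|-> //]; last by left.
  by case: nLe; apply: GL; exact: MG.
by right; apply/seteqP.
Qed.

(** The pair L, L^perp splits at M. A larger flag has a smaller gl-stabilizer, so old members keep
    the condition, and M is its own complement. *)
Lemma inserted_self_taut : self_taut B T'.
Proof.
have cover x : x <> 0 -> exists E F, straddles T' x E F /\
    (orth_closure B E = E \/ orth_closure B E = F).
  move=> x0; have [[Ox nLx]|out] := pselect (orth B L x /\ ~ L x).
    have [Mx|nMx] := pselect (M x).
      by exists L, M; split; [exact: straddles_lower|left].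
    by exists M, (orth B L); split; [exact: straddles_upper|left; rewrite /orth_closure !oM].
  have [E [F h]] := straddles_ex gT x0.
  by exists E, F; split; [exact: straddles_out|exact: (straddles_closure hT h)].
have totM G : T G -> G `<=` M \/ M `<=` G.
  by move=> /side[GL|OG]; [left; exact: subset_trans LM|right; exact: subset_trans OG].
have gT' : generalized_flag T'.
  split=> [F [/(member_subspace gT) //|-> //]|E F [hE|->] [hF|->]|F|x /cover[E [F [h _]]]].
  - exact: (member_total gT hE hF).
  - exact: totM.
  - by case: (totM _ hF); [right|left].
  - by left.
  - move=> [hF|->]; last first.
      by exists L; left; case: (straddles_lower Me nLe).
    have [G hG] : exists G, immediate_pair T G F \/ immediate_pair T F G.
      by case: gT => _ _ /(_ F hF).
    have [x hx] : exists x, straddles T x G F \/ straddles T x F G.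
      by case: hG => /pair_straddles[x hx]; exists x; auto.
    have [[Ox nLx]|out] := pselect (orth B L x /\ ~ L x); last first.
      by exists G; case: hx => /straddles_out/(_ out)[]; auto.
    have hxL : straddles T x L (orth B L) by [].
    exists M; case: hx => h; have [E1 E2] := straddles_uniq gT h hxL.
      by left; rewrite E2; case: (straddles_upper Of nMf).
    by right; rewrite E1; case: (straddles_lower Me nLe).
  - by exists E, F.
split=> // [E F /pair_straddles[x hx]|F hF X [glX sX]].
  have [E' [F' [h' c']]] := cover _ (straddles_nz gT' hx).
  by have [-> ->] := straddles_uniq gT' hx h'.
case: hF => [hF|->]; last by rewrite oM; apply: sX; right.
by case: hT => _ _ hs; apply: hs => //; split=> // G hG; apply: sX; left.
Qed.

Lemma inserted_stabilizer : stabilizer (so_infty B) T' = stabilizer (so_infty B) T.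
Proof.
apply/seteqP; split=> X [soX sX]; split=> // G.
  by move=> hG; apply: sX; left.
case=> [hG|->]; first exact: sX.
by apply: (frame_line_stable iL hef); [exact: so_skew|exact: sX].
Qed.

End Insertion.

(** * Carrying a hyperbolic plane from one flag to another *)

Section Transfer.
Variables (FF GG : set (set V)) (p : set (V -> V)).
Hypotheses (hFF : self_taut B FF) (hGG : self_taut B GG).
Hypotheses (pF : between FF p) (pG : between GG p).
Let gGG : generalized_flag GG. Proof. by case: hGG. Qed.

(** The upper member at e contains L + C e because FF forces L into it; if the lower member is
    closed, the stable subspace L + C e bounds it from above. A nonclosed lower member would have to
    be L, which is closed. *)
Lemma frame_line_member L e f : hyperbolic_plane_member B FF L ->
    hyperbolic_frame L e f -> ~ exceptional GG e ->
  exists E, straddles GG e E (add_line L e).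
Proof.
move=> hL hef nex; have [FL iL cL _] := hL; have [sL _] := iL.
have [Oe _ _ _ _] := hef; have nLe := frame_nmem hef.
have e0 : e <> 0 by move=> e0; apply: nLe; rewrite e0; case: sL.
have [E [F h]] := straddles_ex gGG e0; have [_ Fe nEe] := h.
have sE := member_subspace gGG (straddles_memE h).
have sF := member_subspace gGG (straddles_memF h).
have pM X : p X -> stable X (add_line L e).
  by case: pF => _ ps _ _ /ps; exact: (line_stable hL hef).
have [EM FM] := submod_nonexceptional hGG pG h nex (add_line_subspace e sL) pM
  (add_line_self e sL).
have MF : add_line L e `<=` F.
  apply: (add_line_min sF) => //.
  exact: (submod_exceptional hFF pF hL Oe nLe (stable_member pG (straddles_memF h)) Fe).
have [/FM FM'|nE] := pselect (orth_closure B E = E).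
  by exists E; rewrite (_ : add_line L e = F) //; apply/seteqP.
case: (nE); suff -> : E = L by [].
have EL : E `<=` L.
  move=> y Ey; apply: contrapT => nLy; have [c Lc] := EM _ Ey.
  have Oy : orth B L y by apply: (frame_line_sub iL hef); exact: EM.
  have LE := submod_exceptional hFF pF hL Oy nLy (stable_member pG (straddles_memE h)) Ey.
  apply: nEe; apply: (subspaceZK (a := c) sE).
    by apply/eqP => c0; apply: nLy; move: Lc; rewrite c0 scale0r subr0.
  by have := subspaceB sE Ey (LE _ Lc); rewrite opprB addrC subrK.
apply/seteqP; split=> // l Ll.
have pEe := dense_line_stable hGG pG h nE.
have [c Ec] := submod_exceptional hFF pF hL Oe nLe pEe (add_line_self e sE) Ll.
have [c0|c0] := eqVneq c 0; first by move: Ec; rewrite c0 scale0r subr0.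
case: nLe; apply: (subspaceZK (a := c) sL c0).
by have := subspaceB sL Ll (EL _ Ec); rewrite opprB addrC subrK.
Qed.

(** Otherwise L + C e is a member of GG, and then L + C f is not, so f is exceptional for some L'.
    But L' lies in L + C e, which is its own complement, and this makes e exceptional for the same
    L'. *)
Lemma frame_exceptional L e f : hyperbolic_plane_member B FF L ->
  hyperbolic_frame L e f -> exceptional GG e.
Proof.
move=> hL hef; apply: contrapT => nex; have hfe := hyperbolic_frameC hef.
have [FL iL cL _] := hL; have [sL _] := iL.
have [E he] := frame_line_member hL hef nex.
have GM := straddles_memF he.
have [[L' [hL' Of nL'f]]|nexf] := pselect (exceptional GG f); last first.
  have [E' hf] := frame_line_member hL hfe nexf.
  have [/(_ e (add_line_self e sL))|/(_ f (add_line_self f sL))] :=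
    member_total gGG GM (straddles_memF hf).
    by move/(frame_line_nmem iL hfe).
  by move/(frame_line_nmem iL hef).
have [GL' [_ iL'] _ _] := hL'; have oM := frame_line_orth iL hef.
have nML' : ~ add_line L e `<=` L'.
  by move=> ML'; apply: nL'f; apply: (ML'); rewrite -oM; exact: (orthS ML').
have [//|L'M] := member_total gGG GM GL'.
apply: nex; exists L'; split=> //.
  by apply: (orthS L'M); rewrite oM; exact: add_line_self.
by move=> /(straddles_mem gGG he GL').
Qed.

(** One inclusion is enough: transferring back and the uniqueness of the plane in FF turn it into
    equality. *)
Lemma hyperbolic_transfer L : hyperbolic_plane_member B FF L ->
  exists2 L', hyperbolic_plane_member B GG L' & L' `<=` L.
Proof.
move=> hL; have [FL iL cL q2] := hL; have [sL _] := iL.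
have [e [f hef]] := hyperbolic_frame_ex iL cL q2; have nLe := frame_nmem hef.
have [L' [hL' Oe nL'e]] := frame_exceptional hL hef.
exists L' => //; have [GL' [sL' _] _ _] := hL'.
have pM X : p X -> stable X (add_line L e).
  by case: pF => _ ps _ _ /ps; exact: (line_stable hL hef).
have L'M := submod_exceptional hGG pG hL' Oe nL'e pM (add_line_self e sL).
move=> y L'y; apply: contrapT => nLy; have [c Lc] := L'M _ L'y.
have Oy : orth B L y by apply: (frame_line_sub iL hef); exact: L'M.
have LL' := submod_exceptional hFF pF hL Oy nLy (stable_member pG GL') L'y.
apply: nL'e; apply: (subspaceZK (a := c) sL').
  by apply/eqP => c0; apply: nLy; move: Lc; rewrite c0 scale0r subr0.
by have := subspaceB sL' L'y (LL' _ Lc); rewrite opprB addrC subrK.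
Qed.

End Transfer.

Lemma hyperbolic_same FF GG p L : self_taut B FF -> self_taut B GG ->
    between FF p -> between GG p -> hyperbolic_plane_member B FF L ->
  hyperbolic_plane_member B GG L.
Proof.
move=> hFF hGG pF pG hL.
have [L' hL' L'L] := hyperbolic_transfer hFF hGG pF pG hL.
have [L'' hL'' L''L'] := hyperbolic_transfer hGG hFF pG pF hL'.
have LL'' := hyperbolic_uniq hFF hL'' hL.
by rewrite (_ : L = L') //; apply/seteqP; split=> //; rewrite -LL''.
Qed.

Lemma truncated_same FF GG p L : self_taut B FF -> self_taut B GG ->
    between FF p -> between GG p -> hyperbolic_plane_member B FF L ->
  truncated_flag B FF L = truncated_flag B GG L.
Proof.
move=> hFF hGG pF pG hL; have hL' := hyperbolic_same hFF hGG pF pG hL.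
have [[gFF _ _] [gGG _ _]] := (hFF, hGG).
have gT := truncated_generalized_flag hFF hL.
have gT' := truncated_generalized_flag hGG hL'.
apply: flag_ext => // x E F E' F' h h'; have x0 := straddles_nz gT h.
have [[Ox nLx]|out] := pselect (orth B L x /\ ~ L x).
  have [_ ->] := straddles_uniq gT h (truncated_straddles_in hFF hL Ox nLx).
  by have [_ ->] := straddles_uniq gT' h' (truncated_straddles_in hGG hL' Ox nLx).
have [D [K hx]] := straddles_ex gFF x0; have [D' [K' hx']] := straddles_ex gGG x0.
have [_ ->] := straddles_uniq gT h (truncated_straddles_out hFF hL hx out).
have [_ ->] := straddles_uniq gT' h' (truncated_straddles_out hGG hL' hx' out).
apply: (nonexceptional_eq hFF hGG pF pG hx hx').
  by move=> [K0 [/(hyperbolic_uniq hFF hL) <- ? ?]]; apply: out.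
by move=> [K0 [/(hyperbolic_uniq hGG hL') <- ? ?]]; apply: out.
Qed.

Lemma hyperbolic_trichotomy FF L e f : self_taut B FF ->
    hyperbolic_plane_member B FF L -> hyperbolic_frame L e f ->
  [\/ FF = truncated_flag B FF L,
      FF = truncated_flag B FF L `|` [set add_line L e] |
      FF = truncated_flag B FF L `|` [set add_line L f]].
Proof.
move=> hFF hL hef; have hfe := hyperbolic_frameC hef; have [gFF _ _] := hFF.
have [_ iL _ _] := hL; have [sL _] := iL.
have TF : truncated_flag B FF L `<=` FF by move=> G [].
have chain : ~ (FF (add_line L e) /\ FF (add_line L f)).
  move=> [M1 M2].
  have [/(_ e (add_line_self e sL))|/(_ f (add_line_self f sL))] := member_total gFF M1 M2.
    by move/(frame_line_nmem iL hfe).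
  by move/(frame_line_nmem iL hef).
have inT G : FF G -> [\/ truncated_flag B FF L G, G = add_line L e | G = add_line L f].
  move=> hG; have [GL|OG|GM|GM] := member_between hFF hL hef hG.
  - by constructor 1; split=> //; left.
  - by constructor 1; split=> //; right.
  - by constructor 2.
  - by constructor 3.
have [M1|nM1] := pselect (FF (add_line L e)).
  constructor 2; apply/seteqP; split=> [G hG|G [/TF //|-> //]].
  have [TG|->|GM] := inT G hG; [by left|by right|].
  by case: chain; split=> //; rewrite -GM.
have [M2|nM2] := pselect (FF (add_line L f)).
  constructor 3; apply/seteqP; split=> [G hG|G [/TF //|-> //]].
  by have [TG|GM|->] := inT G hG; [left|case: nM1; rewrite -GM|right].
constructor 1; apply/seteqP; split=> // G hG.
by have [//|GM|GM] := inT G hG; [case: nM1|case: nM2]; rewrite -GM.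
Qed.

Lemma same_stabilizer_hyperbolic FF p L e f : self_taut B FF -> between FF p ->
    hyperbolic_plane_member B FF L -> hyperbolic_frame L e f ->
  same_stabilizer_flags B FF = [set truncated_flag B FF L;
    truncated_flag B FF L `|` [set add_line L e];
    truncated_flag B FF L `|` [set add_line L f]].
Proof.
move=> hFF pF hL hef; have hfe := hyperbolic_frameC hef.
have [_ iL cL q2] := hL; have [sL _] := iL.
set T := truncated_flag B FF L.
have hT : self_taut B T := truncated_self_taut hFF hL.
have [Oe _ _ _ _] := hef; have nLe := frame_nmem hef.
have [imm _ _] := truncated_straddles_in hFF hL Oe nLe.
have he := inserted_self_taut hT iL cL hef imm.
have hf := inserted_self_taut hT iL cL hfe imm.
have ste : stabilizer (so_infty B) (T `|` [set add_line L e]) = stabilizer (so_infty B) T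
  := inserted_stabilizer iL hef imm.
have stf : stabilizer (so_infty B) (T `|` [set add_line L f]) = stabilizer (so_infty B) T
  := inserted_stabilizer iL hfe imm.
have stF : stabilizer (so_infty B) FF = stabilizer (so_infty B) T.
  by have [->|->|->] := hyperbolic_trichotomy hFF hL hef.
apply/seteqP; split=> [GG [hGG st]|GG]; last first.
  by rewrite /same_stabilizer_flags /= stF => -[[->|->]|->]; split.
(* Hence GG shares L and the truncated flag with FF, and only the three listed flags remain. *)
have pG : between GG p by rewrite /between st.
have := hyperbolic_trichotomy hGG (hyperbolic_same hFF hGG pF pG hL) hef.
rewrite -(truncated_same hFF hGG pF pG hL) -/T.
by case=> ->; [left; left|left; right|right].
Qed.

Lemma infinite_trace_between FF p :
  infinite_trace_conditions (stabilizer (so_infty B) FF) p -> between FF p.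
Proof. by case=> Tr [[[sp ps _] mp dp _ _] _]; split. Qed.

Lemma uniquely_determined_nonhyperbolic FF p : self_taut B FF -> between FF p ->
  ~ (exists L, hyperbolic_plane_member B FF L) -> uniquely_determined B FF p.
Proof.
move=> hFF pF noL GG hGG /infinite_trace_between pG.
have [[gFF _ _] [gGG _ _]] := (hFF, hGG).
apply: flag_ext => // x E F E' F' h h'.
apply: (nonexceptional_eq hGG hFF pG pF h h') => -[L [hL _ _]].
  by apply: noL; exists L; exact: (hyperbolic_same hGG hFF pG pF hL).
by apply: noL; exists L.
Qed.

End Form.

Lemma card_set3 (T : Type) (x y z : T) : x <> y -> x <> z -> y <> z ->
  ([set x; y; z] #= `I_3)%card.
Proof.
move=> xy xz yz; pose g n := if n is n'.+1 then if n' is 0%N then y else z else x.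
have -> : [set x; y; z] = g @` `I_3.
  apply/seteqP; split=> [t [[]|] ->|t [[|[|[|//]]] _ <-]].
  - by exists 0%N.
  - by exists 1%N.
  - by exists 2%N.
  - by left; left.
  - by left; right.
  - by right.
apply: inj_card_eq => -[|[|[|n]]] [|[|[|m]]] //=; rewrite ?in_setE //= => _ _ h.
all: congruence.
Qed.

Theorem theorem2p8 (R : realType) (V : lmodType R[i]) (B : {symmetric V})
    (hV : countable_dimensional V) (hB : nondegenerate_form B)
    (FF : set (set V)) (p : set (V -> V))
    (hFF : self_taut B FF)
    (hp : parabolic_subalgebra (so_infty B) p)
    (hTr : infinite_trace_conditions (stabilizer (so_infty B) FF) p) :
  [/\ uniquely_determined B FF p \/
        (same_stabilizer_flags B FF #= `I_3)%card,
      (same_stabilizer_flags B FF #= `I_3)%card <->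
        (exists L : set V, hyperbolic_plane_member B FF L) &
      forall L : set V, hyperbolic_plane_member B FF L ->
        exists M1 M2 : set V,
          two_maximal_isotropics B L M1 M2 /\
          same_stabilizer_flags B FF =
            [set truncated_flag B FF L;
                 truncated_flag B FF L `|` [set M1];
                 truncated_flag B FF L `|` [set M2]]].
Proof.
have pF := infinite_trace_between hTr.
have hyp L : hyperbolic_plane_member B FF L -> exists M1 M2 : set V,
    two_maximal_isotropics B L M1 M2 /\
    same_stabilizer_flags B FF = [set truncated_flag B FF L;
      truncated_flag B FF L `|` [set M1]; truncated_flag B FF L `|` [set M2]] /\
    (same_stabilizer_flags B FF #= `I_3)%card.
  move=> hL; have [_ iL cL q2] := hL.
  have [e [f hef]] := hyperbolic_frame_ex iL cL q2.
  have hfe := hyperbolic_frameC hef.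
  exists (add_line L e), (add_line L f); split.
    exact: two_maximal_isotropics_frame iL hef.
  have eqS := same_stabilizer_hyperbolic hB hFF pF hL hef.
  split=> //; rewrite eqS; have [sL _] := iL; have [Oe _ _ _ _] := hef.
  have nT e1 f1 : hyperbolic_frame B L e1 f1 -> ~ truncated_flag B FF L (add_line L e1).
    move=> h1; have [_ O1 _ _ _] := h1 => -[_ [ML|OM]].
      by apply: (frame_nmem h1); apply: ML; exact: add_line_self.
    by apply: (frame_line_nmem iL h1); exact: OM.
  apply: card_set3 => h.
  - by apply: (nT _ _ hef); rewrite h; right.
  - by apply: (nT _ _ hfe); rewrite h; right.
  - have : (truncated_flag B FF L `|` [set add_line L f]) (add_line L e).
      by rewrite -h; right.
    case=> [/(nT _ _ hef) //|ef].
    by apply: (frame_line_nmem iL hfe); rewrite -ef; exact: add_line_self.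
have uniq : ~ (exists L, hyperbolic_plane_member B FF L) -> uniquely_determined B FF p.
  exact: uniquely_determined_nonhyperbolic.
split.
- have [[L /hyp[M1 [M2 [_ []]]]]|/uniq] := pselect (exists L, hyperbolic_plane_member B FF L).
    by right.
  by left.
- split=> [card3|[L /hyp[M1 [M2 [_ []]]]]] //.
  apply: contrapT => /uniq uq.
  (* A flag with the same stabilizer satisfies the same trace conditions for [p], so uniqueness
     leaves one flag, not three. *)
  have eqS : same_stabilizer_flags B FF = [set FF].
    apply/seteqP; split=> [GG [hGG st]|GG -> //].
    by apply: uq => //; rewrite st.
  rewrite eqS in card3.
  by have /card_eq_II := card_eq_trans (card_esym card_set1) card3.
- by move=> L /hyp[M1 [M2 [h [h' _]]]]; exists M1, M2.
Qed.
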